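(* Assume the Continuum Hypothesis. For every $x\in\omega^*=\beta\omega\setminus\omega$ the following hold: (a) $\omega^*\setminus\{x\}$ has arbitrarily large finite compactifications; (b) every finite compactification of $\omega^*\setminus\{x\}$ is homeomorphic to $\omega^*$; and (c) for every finite compactification $Z$ of $\omega^*\setminus\{x\}$, all but at most one of the points at infinity are $P$-points of $Z$.
   Context: $\beta\omega$ is the Stone-Čech compactification of the countable discrete space $\omega$. A compactification of a space $Y$ is a compact Hausdorff space $Z$ containing $Y$ as a dense subspace; it is finite if its remainder $Z\setminus Y$ is finite, and the elements of $Z\setminus Y$ are the points at infinity. ''Arbitrarily large finite compactifications'' means that for every $n\in\mathbb{N}$ there is a finite compactification whose remainder has at least $n$ points. A $P$-point of a space is a point $p$ such that every countable intersection of neighbourhoods of $p$ contains a neighbourhood of $p$. *)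

(* Defs.v *)
From mathcomp Require Import all_boot all_classical topology.

Set Implicit Arguments.
Unset Strict Implicit.
Unset Printing Implicit Defensive.

Local Open Scope classical_set_scope.
Local Open Scope card_scope.

Definition continuum_hypothesis : Prop :=
  forall A : set (set nat), countable A \/ A #= [set: set nat].

Definition homeomorphic (X Y : topologicalType) : Prop :=
  exists (f : X -> Y) (g : Y -> X),
    [/\ cancel f g, cancel g f, continuous f & continuous g].

(* [X] carries exactly the topology it inherits as a subspace of [Z]. *)
Definition embedding (X Z : topologicalType) (j : X -> Z) : Prop :=
  injective j /\
  forall U : set X, open U <-> exists2 V : set Z, open V & j @^-1` V = U.

Definition compactification (X Z : topologicalType) (j : X -> Z) : Prop :=
  [/\ compact [set: Z], hausdorff_space Z, embedding j & dense (range j)].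

Definition remainder (X Z : topologicalType) (j : X -> Z) : set Z :=
  ~` range j.

Definition finite_compactification (X Z : topologicalType) (j : X -> Z) : Prop :=
  compactification j /\ finite_set (remainder j).

(* The extension [g] is unique, since [range e] is dense and [K] is Hausdorff;
   hence [e] is determined up to a homeomorphism fixing [X]. *)
Definition stone_cech_compactification (X B : topologicalType) (e : X -> B) : Prop :=
  compactification e /\
  forall (K : topologicalType) (f : X -> K),
    compact [set: K] -> hausdorff_space K -> continuous f ->
    exists2 g : B -> K, continuous g & g \o e = f.

Definition P_point (X : topologicalType) : set X :=
  [set p | forall U : nat -> set X,
     (forall n, nbhs p (U n)) -> nbhs p (\bigcap_n U n)].

(* Main.v *)
(* Call a space Parovichenko if it has the properties by which Parovichenko
   characterised omega* under CH: compact Hausdorff, zero-dimensional, without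
   isolated points, of weight at most the continuum, an F-space, and such that
   nonempty G_delta sets have nonempty interior.  A back-and-forth construction
   along a well-order of the continuum with countable initial segments shows
   that any two Parovichenko spaces are homeomorphic.

   A finite compactification Z of K \ {x}, with K Parovichenko, maps onto K by
   collapsing the remainder to x, and the properties of K lift along this map:
   a clopen set in Z contains a given point at infinity or its complement does,
   and a clopen set avoiding the remainder is the preimage of a clopen set of K.
   This gives (b).  If two points at infinity were not P-points, there would be
   disjoint open F_sigma sets of K both accumulating at x, which an F-space
   forbids; this gives (c).  For (a), a coherent family of colourings of clopen
   sets missing x, built along the well-order, splits K \ {x} into open sets
   all accumulating at x, and x is replaced by one point for each of them. *)

Require Import Defs.
From mathcomp Require Import all_boot all_classical topology.
From mathcomp Require wochoice.

Set Implicit Arguments.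
Unset Strict Implicit.
Unset Printing Implicit Defensive.

Local Open Scope classical_set_scope.
Local Open Scope card_scope.

(** * Well-orders of the continuum *)

Definition strict_well_order (T : Type) (R : T -> T -> Prop) : Prop :=
  [/\ well_founded R, (forall s t u, R s t -> R t u -> R s u)
    & forall s t, [\/ R s t, s = t | R t s]].

(** The well-ordering principle used here only provides a unique least element in each nonempty
    subset; the order axioms come from subsets of one, two and three elements. *)
Lemma strict_well_order_ex (T : eqType) :
  exists R : T -> T -> Prop, strict_well_order R.
Proof.
have [R woR] := wochoice.well_ordering_principle T.
have refl s : R s s.
  have [|z [[zs lbz] _]] := woR (pred1 s); first by exists s; rewrite inE.
  by move: zs (lbz s); rewrite !inE => /eqP-> /(_ (eqxx s)).
have anti : antisymmetric R.
  move=> s t /andP[st ts].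
  have [|z [_ uz]] := woR [pred u | (u == s) || (u == t)].
    by exists s; rewrite !inE eqxx.
  rewrite -(uz s); last first.
    by split=> [|u]; rewrite !inE ?eqxx// => /orP[]/eqP->.
  by apply: uz; split=> [|u]; rewrite !inE ?eqxx ?orbT// => /orP[]/eqP->.
have min (A : {pred T}) : (exists x, x \in A) ->
    exists2 z, z \in A & forall x, x \in A -> R z x.
  by move=> /woR[z [[zA lbz] _]]; exists z.
have tot s t : R s t \/ R t s.
  have [|z] := min [pred u | (u == s) || (u == t)].
    by exists s; rewrite !inE eqxx.
  rewrite !inE => /orP[/eqP->|/eqP->] lbz; [left|right]; apply: lbz.
    by rewrite !inE eqxx orbT.
  by rewrite !inE eqxx.
have trans s t u : R s t -> R t u -> R s u.
  move=> st tu.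
  have [|z] := min [pred v | [|| v == s, v == t | v == u]].
    by exists s; rewrite !inE eqxx.
  rewrite !inE => zP lbz.
  have zs : R z s by apply: lbz; rewrite !inE eqxx.
  have zt : R z t by apply: lbz; rewrite !inE eqxx orbT.
  have zu : R z u by apply: lbz; rewrite !inE eqxx !orbT.
  case/or3P: zP => /eqP zE; subst z => //.
    by have -> : s = t by apply: anti; rewrite st zs.
  have ut : u = t by apply: anti; rewrite zt tu.
  by subst u; have -> : s = t by apply: anti; rewrite st zs.
exists (fun s t => R s t /\ s <> t); split.
- move=> t; apply: contrapT => nacc.
  pose A := [pred u | `[< ~ Acc (fun s t => R s t /\ s <> t) u >]].
  have AP u : reflect (~ Acc (fun s t => R s t /\ s <> t) u) (u \in A).
    exact: asboolP.
  have [|z /AP nz lbz] := min A; first by exists t; apply/AP.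
  apply: nz; constructor => u [uz neq]; apply: contrapT => nu; apply: neq.
  by apply: anti; rewrite uz /=; apply/lbz/AP.
- move=> s t u [st nst] [tu ntu]; split; first exact: trans tu.
  by move=> E; subst u; apply: nst; apply: anti; rewrite st tu.
- move=> s t; have [->|/eqP neq] := eqVneq s t; first by constructor 2.
  have [st|ts] := tot s t; first by constructor 1.
  by constructor 3; split => // E; apply: neq.
Qed.

(** If some initial segment is uncountable, the first [t0] with this property bounds a segment that
    CH makes equipotent to [set nat]; its order is pulled back along a bijection [f]. *)
Lemma continuum_well_order (CH : continuum_hypothesis) :
  exists R : set nat -> set nat -> Prop,
    strict_well_order R /\ forall t, countable [set s | R s t].
Proof.
have [R [wfR trR totR]] := strict_well_order_ex (set nat).
have [allc|] := pselect (forall t, countable [set s | R s t]).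
  by exists R; split.
move=> /existsNP[t nct].
have [t0 [nct0 mint0]] : exists t0, ~ countable [set s | R s t0] /\
    forall s, R s t0 -> countable [set u | R u s].
  elim/(well_founded_ind wfR): t nct => t IH nct.
  have [c|/existsNP[s /not_implyP[Rst ncs]]] :=
    pselect (forall s, R s t -> countable [set u | R u s]); first by exists t.
  exact: IH Rst ncs.
have [//|] := CH [set s | R s t0].
rewrite card_eq_sym => /card_set_bijP[f [fR finj _]].
have fI s t' : f s = f t' -> s = t' by apply: finj; rewrite inE.
exists (fun s t => R (f s) (f t)); split; [split|].
- suff acc u : forall s, f s = u -> Acc (fun s t => R (f s) (f t)) s.
    by move=> s; exact: acc.
  elim/(well_founded_ind wfR): u => u IH s su.
  by constructor => s'; rewrite su => ltu; exact: IH ltu s' (erefl _).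
- by move=> ? ? ?; exact: trR.
- move=> s t'; have [?|/fI|?] := totR (f s) (f t').
  + by constructor 1.
  + by constructor 2.
  + by constructor 3.
- move=> t'; have := mint0 (f t') (fR t' I); apply: sub_countable.
  apply/pcard_leP/injfunPex => /=; exists f; first by move=> s.
  by move=> s s' _ _ /fI.
Qed.

(** Transfinite recursion with a choice at each step. By the locality hypothesis, the condition at
    [t] depends only on the values below [t]. *)
Lemma well_founded_choice (T V : Type) (v0 : V) (R : T -> T -> Prop)
    (P : T -> (T -> V) -> V -> Prop) :
  well_founded R ->
  (forall t f g v, (forall s, R s t -> f s = g s) -> P t f v -> P t g v) ->
  (forall t f, (forall s, R s t -> P s f (f s)) -> exists v, P t f v) ->
  exists f, forall t, P t f (f t).
Proof.
move=> wfR Ploc Pex.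
(* [ext] completes a function on the predecessors of [t] by the arbitrary value [v0], which locality
   hides from [P]. *)
pose ext t (f : forall s, R s t -> V) s :=
  if pselect (R s t) is left h then f s h else v0.
pose step t (f : forall s, R s t -> V) :=
  if pselect (exists v, P t (ext t f) v) is left h then projT1 (cid h) else v0.
pose F := Fix wfR (fun=> V) step.
have FE t : F t = step t (fun s _ => F s).
  rewrite /F Fix_eq // => u f g fg; congr step.
  by apply: functional_extensionality_dep => s; apply: funext => h.
exists F => t; elim/(well_founded_ind wfR): t => t IH.
have /(Pex t)[v Pv] : forall s, R s t -> P s F (F s) by [].
have agree s : R s t -> F s = ext t (fun s _ => F s) s.
  by rewrite /ext; case: pselect.
have Pv' := Ploc _ _ _ _ agree Pv.
rewrite FE /step; case: pselect => [h|]; last by case; exists v.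
apply: Ploc (projT2 (cid h)) => s Rst; by rewrite agree.
Qed.

(** * Parovichenko spaces *)

(** The value [d] fills the indices that enumerate nothing, so [D] may be finite or empty. *)
Lemma countable_enum (T : Type) (D : set T) (d : T) : countable D ->
  exists u : nat -> T,
    (forall x, D x -> exists n, u n = x) /\ forall n, D (u n) \/ u n = d.
Proof.
move=> /countable_injP[f finj].
have /choice[u uP] : forall n, exists un : T,
    (forall x, D x -> f x = n -> un = x) /\ (D un \/ un = d).
  move=> n.
  have [[x [Dx fx]]|nx] := pselect (exists x, D x /\ f x = n).
    exists x; split=> [y Dy fy|]; last by left.
    by apply: finj; rewrite ?inE// fx fy.
  by exists d; split=> [x Dx fx|]; [case: nx; exists x|right].
exists u; split=> [x Dx|n]; last by have [] := uP n.
by exists (f x); have [+ _] := uP (f x); exact.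
Qed.

Lemma countable_setU (T : Type) (A B : set T) :
  countable A -> countable B -> countable (A `|` B).
Proof.
by move=> cA cB; rewrite -bigcup2E; apply: bigcup_countable => // -[|[|n]] _ //.
Qed.

Lemma countable_im (T U : Type) (f : T -> U) (A : set T) :
  countable A -> countable (f @` A).
Proof. exact/sub_countable/card_image_le. Qed.

Lemma decreasing_subset (T : Type) (C : nat -> set T) :
  (forall n, C n.+1 `<=` C n) -> forall m n, m <= n -> C n `<=` C m.
Proof.
move=> decC m; elim=> [|n IH]; first by rewrite leqn0 => /eqP->.
rewrite leq_eqVlt => /predU1P[->//|]; rewrite ltnS => /IH h z /decC; exact: h.
Qed.

(** * Compactness for families of closed and clopen sets *)

Section compact_clopen.
Variable K : topologicalType.

Lemma compact_directed (I : Type) (D : set I) (F : I -> set K) :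
  compact [set: K] -> D !=set0 ->
  (forall i j, D i -> D j -> exists2 k, D k & F k `<=` F i `&` F j) ->
  (forall i, D i -> closed (F i) /\ F i !=set0) ->
  exists p, forall i, D i -> F i p.
Proof.
move=> cK D0 dirF clF.
have FF : Filter (filter_from D F).
  by apply: filter_from_filter => // i j Di Dj; have [k] := dirF i j Di Dj; exists k.
have PF : ProperFilter (filter_from D F).
  by apply: filter_from_proper => i /clF[].
have [p [_ clp]] := cK _ PF filterT.
exists p => i Di; have [cl _] := clF i Di; apply: cl => B Bp.
by apply: clp => //; exists i.
Qed.

Lemma compact_decreasing (C : nat -> set K) :
  compact [set: K] -> (forall n, closed (C n)) ->
  (forall n, C n.+1 `<=` C n) -> (forall n, C n !=set0) ->
  exists p, forall n, C n p.
Proof.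
move=> cK clC decC C0.
have decC' := decreasing_subset decC.
have [|i j _ _|i _|p Cp] := @compact_directed nat setT C cK.
- by exists 0.
- by exists (maxn i j) => //; rewrite subsetI; split;
    apply: decC'; rewrite ?leq_maxl ?leq_maxr.
- by split.
- by exists p => n; exact: Cp.
Qed.

(** Otherwise the complements of the clopen sets in [P] are directed, closed and nonempty, hence
    share a point, against the local hypothesis. This serves to pass from local to global
    statements. *)
Lemma clopen_induction (P : set (set K)) :
  compact [set: K] -> P set0 ->
  (forall A B, P A -> P B -> P (A `|` B)) ->
  (forall z, exists T, [/\ clopen T, T z & P T]) -> P setT.
Proof.
move=> cK P0 PU Ploc; apply: contrapT => nPT.
have [|A B [cA PA] [cB PB]|A [[oA cA] PA]|z Pz] :=
    @compact_directed _ [set A | clopen A /\ P A] setC cK.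
- by exists set0; split; first exact: clopen0.
- by exists (A `|` B); [split; [exact: clopenU|exact: PU]|rewrite setCU].
- split; first exact: open_closedC.
  by apply/set0P/eqP => A0; apply: nPT; rewrite -setC0 -A0 setCK.
- by have [T [cT Tz PT]] := Ploc z; apply: (Pz T).
Qed.

End compact_clopen.

(* Given the clopen base, [parovichenko_gdelta] says that nonempty G_delta sets
   have nonempty interior, and [parovichenko_separation] that disjoint open
   F_sigma sets have disjoint closures. *)
Record parovichenko (K : topologicalType) : Prop := Parovichenko {
  parovichenko_compact : compact [set: K];
  parovichenko_hausdorff : hausdorff_space K;
  parovichenko_base : forall (U : set K) z, open U -> U z ->
    exists C, [/\ clopen C, C z & C `<=` U];
  parovichenko_nonempty : [set: K] !=set0;
  parovichenko_perfect : forall z : K, ~ open [set z];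
  parovichenko_gdelta : forall C : nat -> set K,
    (forall n, clopen (C n)) -> (forall n, C n.+1 `<=` C n) ->
    (forall n, C n !=set0) ->
    exists D, [/\ clopen D, D !=set0 & forall n, D `<=` C n];
  parovichenko_separation : forall F G : set (set K),
    countable F -> countable G -> F `<=` clopen -> G `<=` clopen ->
    (forall A B, F A -> G B -> A `&` B = set0) ->
    exists S, [/\ clopen S, forall A, F A -> A `<=` S
                & forall B, G B -> B `<=` ~` S];
  parovichenko_card : exists g : set nat -> set K,
    forall C, clopen C -> exists s, g s = C }.

Lemma clopenD (K : topologicalType) (A B : set K) :
  clopen A -> clopen B -> clopen (A `\` B).
Proof. by move=> cA cB; apply: clopenI => //; exact: clopenC. Qed.

Lemma closed_point (K : topologicalType) (z : K) :
  hausdorff_space K -> closed [set z].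
Proof. by move=> hK; apply/accessible_closed_set1/hausdorff_accessible. Qed.

Section parovichenko_theory.
Variables (K : topologicalType) (pK : parovichenko K).

Lemma parovichenko_sep (z z' : K) : z <> z' ->
  exists C, [/\ clopen C, C z & ~ C z'].
Proof.
move=> zz'; have [|//|C [cC Cz CU]] := parovichenko_base pK (U := ~` [set z']) (z := z).
  exact/closed_openC/closed_point/(parovichenko_hausdorff pK).
by exists C; split => // /CU; exact.
Qed.

Lemma parovichenko_split (D : set K) : clopen D -> D !=set0 ->
  exists D0 D1, [/\ clopen D0 /\ clopen D1, D0 !=set0 /\ D1 !=set0,
    D0 `<=` D /\ D1 `<=` D & D0 `&` D1 = set0].
Proof.
move=> cD [z Dz].
have [z' Dz' zz'] : exists2 z', D z' & z <> z'.
  apply: contrapT => nz; apply: (parovichenko_perfect pK (z := z)).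
  rewrite (_ : [set z] = D); first by case: cD.
  apply/seteqP; split=> [_ ->//|z' Dz']; apply: contrapT => /= zz'.
  by apply: nz; exists z' => // /esym.
have [C [cC Cz nCz']] := parovichenko_sep zz'.
exists (D `&` C), (D `\` C); split.
- by split; [exact: clopenI|exact: clopenD].
- by split; [exists z|exists z'].
- by split=> [y []|y []].
- by rewrite setIACA setICr setI0.
Qed.

End parovichenko_theory.

(** * Extending an isomorphism of countable Boolean algebras by one clopen set *)

Definition cylinder (s : seq bool) (m : set nat) : Prop :=
  forall k, k < size s -> (m k <-> nth false s k).

Definition prefix_of (m : set nat) (n : nat) : seq bool :=
  mkseq (fun k => `[< m k >]) n.

Lemma cylinder_prefix_of m n m' :
  cylinder (prefix_of m n) m' <-> forall k, k < n -> (m' k <-> m k).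
Proof.
rewrite /cylinder size_mkseq; split=> h k kn.
  by rewrite h// nth_mkseq//; split=> /asboolP.
by rewrite nth_mkseq// h//; split=> /asboolP.
Qed.

Section trace.
Variables (K : topologicalType) (P : nat -> set K).
Hypothesis cP : forall n, clopen (P n).
(** The map into the Cantor space [set nat] induced by the sequence [P]; the cylinders are the basic
    clopen sets of that space. *)
Definition trace (z : K) : set nat := [set n | P n z].

Lemma clopen_cylinder s : clopen [set z | cylinder s (trace z)].
Proof.
rewrite /cylinder; elim: (size s) => [|n IH].
  by rewrite (_ : mkset _ = setT); [exact: clopenT|apply/seteqP].
pose E := if nth false s n then P n else ~` P n.
have cE : clopen E by rewrite /E; case: ifP => _ //; exact: clopenC.
rewrite (_ : mkset _ = E `&` [set z | forall k, k < n -> (trace z k <-> nth false s k)]).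
  exact: clopenI.
apply/seteqP; split=> z /=.
  move=> h; split=> [|k kn]; last by apply: h; rewrite ltnS ltnW.
  have := h n (ltnSn n); rewrite /E /trace /=.
  by case: nth => -[h1 h2] //=; [exact: h2|move/h1].
move=> [Ez h] k; rewrite ltnS leq_eqVlt => /predU1P[->|]; last exact: h.
by move: Ez; rewrite /E /trace /=; case: nth.
Qed.

(** Agreement with [m] up to length [n] cuts out of [A] a decreasing sequence of nonempty closed
    sets; by compactness some point agrees throughout. *)
Lemma trace_approx (A : set K) m : compact [set: K] -> closed A ->
  (forall n, exists2 z, A z & cylinder (prefix_of m n) (trace z)) ->
  exists2 z, A z & trace z = m.
Proof.
move=> cK clA Am.
have [n|n z [Az]|n|z Az] :=
    @compact_decreasing _ (fun n => A `&` [set z | cylinder (prefix_of m n) (trace z)]) cK.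
- by apply: closedI => //; have [] := clopen_cylinder (prefix_of m n).
- move=> /= /cylinder_prefix_of h; split=> //=.
  by apply/cylinder_prefix_of => k kn; apply: h; rewrite ltnS ltnW.
- by have [z] := Am n; exists z.
- exists z; first by have [] := Az 0.
  apply/seteqP; split=> k; have [_ /= /cylinder_prefix_of/(_ k (ltnSn k))[h1 h2]] := Az k.+1.
    exact: h1.
  exact: h2.
Qed.

End trace.

Section extension.
Variables (K L : topologicalType) (pK : parovichenko K) (pL : parovichenko L).
Variables (P : nat -> set K) (Q : nat -> set L).
Hypotheses (cP : forall n, clopen (P n)) (cQ : forall n, clopen (Q n)).
Hypothesis totK : forall z, exists y, trace Q y = trace P z.
Hypothesis totL : forall y, exists z, trace P z = trace Q y.

(* The fibres of [trace Q] are nonempty G_delta sets, so they contain clopen sets.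
   Two disjoint ones per fibre allow [extend_clopen] to make both [b] and its
   complement meet the fibres that they must meet. *)
Lemma fiber_split : exists h0 h1 : set nat -> set L,
  (forall m, clopen (h0 m) /\ clopen (h1 m)) /\
  forall m, (exists y, trace Q y = m) ->
  [/\ h0 m !=set0 /\ h1 m !=set0,
    forall y, h0 m y -> trace Q y = m, forall y, h1 m y -> trace Q y = m
    & h0 m `&` h1 m = set0].
Proof.
suff /choice[h hP] : forall m, exists h : set L * set L,
   (clopen h.1 /\ clopen h.2) /\ ((exists y, trace Q y = m) ->
   [/\ h.1 !=set0 /\ h.2 !=set0,
    forall y, h.1 y -> trace Q y = m, forall y, h.2 y -> trace Q y = m
    & h.1 `&` h.2 = set0]).
  exists (fun m => (h m).1), (fun m => (h m).2); split=> m; first by have [] := hP m.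
  by have [_ +] := hP m; exact.
move=> m; have [[y my]|nm] := pselect (exists y, trace Q y = m); last first.
  by exists (set0, set0); split=> //; split; exact: clopen0.
have [n|n z|n|D [cD D0 DC]] := parovichenko_gdelta pL
    (C := fun n => [set z | cylinder (prefix_of m n) (trace Q z)]).
- exact: clopen_cylinder.
- move=> /= /cylinder_prefix_of h.
  by apply/cylinder_prefix_of => k kn; apply: h; rewrite ltnS ltnW.
- by exists y => /=; apply/cylinder_prefix_of; rewrite my.
have Dm z : D z -> trace Q z = m.
  move=> Dz; apply/seteqP; split=> k;
  have [h1 h2] := (cylinder_prefix_of m k.+1 (trace Q z)).1 (DC k.+1 z Dz) k (ltnSn k).
    exact: h1.
  exact: h2.
have [D1 [D2 [? ? [s1 s2] ?]]] := parovichenko_split pL cD D0.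
by exists (D1, D2); split => // _; split => // z /= ?; apply: Dm; [exact: s1|exact: s2].
Qed.

(** The set [b] must contain each cylinder whose counterpart in [K] lies inside [a], and part of a
    fibre for each cylinder that meets [a]; its complement must do the same for the complement of
    [a]. These are countable families, so the F-space property provides [b]. *)
Lemma extend_clopen (a : set K) : clopen a -> exists b : set L,
  [/\ clopen b,
    forall z, exists y, trace Q y = trace P z /\ (b y <-> a z)
  & forall y, exists z, trace P z = trace Q y /\ (b y <-> a z)].
Proof.
move=> ca; have [h0 [h1 [ch hP]]] := fiber_split.
have [z0 _] := parovichenko_nonempty pK.
(* [pt (A, s)] is a point of [A] in the cylinder of [s] if there is one, and arbitrary otherwise. *)
have /choice[pt ptP] : forall u : set K * seq bool, exists z,
    (exists2 z, u.1 z & cylinder u.2 (trace P z)) ->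
    u.1 z /\ cylinder u.2 (trace P z).
  move=> u; have [[z az cz]|nz] :=
    pselect (exists2 z, u.1 z & cylinder u.2 (trace P z)); first by exists z.
  by exists z0.
pose cyl s := [set y | cylinder s (trace Q y)].
pose fam (A : set K) (h : set nat -> set L) : set (set L) :=
  cyl @` [set s | forall z, cylinder s (trace P z) -> A z] `|`
  (fun s => h (trace P (pt (A, s)))) @`
    [set s | exists2 z, A z & cylinder s (trace P z)].
have cfam A h : countable (fam A h).
  by rewrite /fam; apply: countable_setU; apply: countable_im; exact: countableP.
have clfam A h : (forall m, clopen (h m)) -> fam A h `<=` clopen.
  by move=> clh _ [[s _ <-]|[s _ <-]]; [exact: clopen_cylinder|].
have surj A h (S : set L) : clopen S -> closed A ->
    (forall m, (exists y, trace Q y = m) ->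
      h m !=set0 /\ forall y, h m y -> trace Q y = m) ->
    (forall B, fam A h B -> B `<=` S) ->
    forall z, A z -> exists2 y, S y & trace Q y = trace P z.
  move=> cS clA hm famS z Az.
  apply: (trace_approx cQ (parovichenko_compact pL)); first by case: cS.
  move=> n; set s := prefix_of _ n.
  have As : exists2 z, A z & cylinder s (trace P z).
    by exists z => //; apply/cylinder_prefix_of.
  have [Apt cpt] := ptP (A, s) As.
  have [[y hy] hQ] := hm _ (totK (pt (A, s))).
  exists y; last by rewrite hQ.
  by apply: famS hy; right; exists s.
(* If no point outside [A] agreed with [y] up to length [n], the whole cylinder around [y] would
   belong to [fam A h] and lie in [S]. *)
have into A h (S : set L) : closed (~` A) ->
    (forall B, fam A h B -> B `<=` S) ->
    forall y, ~ S y -> exists2 z, (~` A) z & trace P z = trace Q y.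
  move=> clA famS y nSy.
  apply: (trace_approx cP (parovichenko_compact pK)) => // n.
  apply: contrapT => nz; apply: nSy.
  apply: (famS (cyl (prefix_of (trace Q y) n))); last first.
    by rewrite /cyl/=; apply/cylinder_prefix_of.
  left; exists (prefix_of (trace Q y) n) => // z cz; apply: contrapT => nAz.
  by apply: nz; exists z.
have [| | | |A B|b [cb Fb Gb]] :=
  parovichenko_separation pL (F := fam a h0) (G := fam (~` a) h1).
- exact: cfam.
- exact: cfam.
- by apply: clfam => m; have [] := ch m.
- by apply: clfam => m; have [] := ch m.
- move=> FA GB; apply/seteqP; split=> // y [].
  case: FA => -[s sP <-]; case: GB => -[s' s'P <-] /=.
  + rewrite /cyl/=; have [z <-] := totL y => cs cs'.
    by apply: (s'P _ cs'); exact: sP.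
  + have [nz cpt] := ptP (~` a, s') s'P.
    have [_ _ h _] := hP _ (totK (pt (~` a, s'))).
    by rewrite /cyl/= => + /h yE; rewrite yE => /sP.
  + have [az cpt] := ptP (a, s) sP.
    have [_ h _ _] := hP _ (totK (pt (a, s))).
    by rewrite /cyl/= => /h ->  /s'P.
  + have [_ h0P _ dis] := hP _ (totK (pt (a, s))).
    have [_ _ h1P _] := hP _ (totK (pt (~` a, s'))).
    move=> y0 y1; have yE := h0P _ y0; have yE' := h1P _ y1.
    suff : (h0 (trace P (pt (a, s))) `&` h1 (trace P (pt (a, s)))) y by rewrite dis.
    by split => //; rewrite -yE yE'.
have cCb := clopenC set0 cb; have cCa := clopenC set0 ca.
exists b; split => // [z|y].
  have [az|naz] := pselect (a z).
    have [| |m /hP[[? ?] ? ? ?]| |y by_ Qy] // := surj a h0 b _ _ _ _ z az.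
      by case: ca.
    by exists y; split.
  have [| |m /hP[[? ?] ? ? ?]| |y nby Qy] // :=
    surj (~` a) h1 (~` b) _ _ _ _ z naz; first by case: cCa.
  by exists y; split=> //; split.
have [by_|nby] := pselect (b y).
  have [|B /Gb //|//|z] := into (~` a) h1 (~` b) _ _ y; first by rewrite setCK; case: ca.
  by rewrite setCK => az Pz; exists z.
have [|B /Fb //|//|z naz Pz] := into a h0 b _ _ y; first by case: cCa.
by exists z; split => //; split.
Qed.

End extension.

(** * Back and forth *)

(* By compactness, [r] extends to an isomorphism between the Boolean algebras of
   clopen sets generated by its two projections iff [matched r] is total in both
   directions. *)
Definition matched (K L : Type) (r : set (set K * set L)) (z : K) (y : L) : Prop :=
  forall p, r p -> (p.1 z <-> p.2 y).

Definition partial_iso (K L : topologicalType) (r : set (set K * set L)) : Prop :=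
  [/\ forall p, r p -> clopen p.1 /\ clopen p.2,
    forall z, exists y, matched r z y & forall y, exists z, matched r z y].

Definition swapped (K L : Type) (r : set (set K * set L)) : set (set L * set K) :=
  [set p | r (p.2, p.1)].

Lemma partial_iso_swapped (K L : topologicalType) (r : set (set K * set L)) :
  partial_iso r -> partial_iso (swapped r).
Proof.
move=> [cr tK tL]; split=> [[b a] /cr[]//|y|z].
  have [z m] := tL y; exists z => -[b a] /m /= h.
  exact: iff_sym.
have [y m] := tK z; exists y => -[b a] /m /= h.
exact: iff_sym.
Qed.

(** The partners of [z] under the members of the chain form a directed family of nonempty closed
    sets, so compactness finds a common one. *)
Lemma partial_iso_total (K L : topologicalType) (I : Type) (D : set I)
    (F : I -> set (set K * set L)) :
  compact [set: L] -> [set: L] !=set0 ->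
  (forall i j, D i -> D j -> F i `<=` F j \/ F j `<=` F i) ->
  (forall i, D i -> partial_iso (F i)) ->
  forall z, exists y, matched (\bigcup_(i in D) F i) z y.
Proof.
move=> cL [y0 _] ch pF z.
have [D0|nD] := pselect (D !=set0); last first.
  by exists y0 => p [i Di]; case: nD; exists i.
have [i j Di Dj|i Di|y my] :=
    @compact_directed L I D (fun i => [set y | matched (F i) z y]) cL D0.
- by have [s|s] := ch i j Di Dj; [exists j|exists i] => // y my; split=> // p /s/my.
- have [cF tF _] := pF i Di; split; last exact: tF.
  rewrite (_ : mkset _ = \bigcap_(p in F i) [set y | p.1 z <-> p.2 y]).
    apply: closed_bigI => p /cF[_ cp2].
    have [pz|npz] := pselect (p.1 z).
      rewrite (_ : mkset _ = p.2); first by case: cp2.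
      by apply/seteqP; split=> y /=; [case=> + _; exact|split].
    rewrite (_ : mkset _ = ~` p.2); first by have [] := clopenC set0 cp2.
    by apply/seteqP; split=> y /=; [case=> _ h /h|split].
  by apply/seteqP; split.
- by exists y => p [i Di Fp]; exact: my Fp.
Qed.

Lemma partial_iso_bigcup (K L : topologicalType) (I : Type) (D : set I)
    (F : I -> set (set K * set L)) :
  compact [set: K] -> [set: K] !=set0 -> compact [set: L] -> [set: L] !=set0 ->
  (forall i j, D i -> D j -> F i `<=` F j \/ F j `<=` F i) ->
  (forall i, D i -> partial_iso (F i)) ->
  partial_iso (\bigcup_(i in D) F i).
Proof.
move=> cK K0 cL L0 ch pF; split.
- by move=> p [i /pF[cF _ _] /cF].
- exact: partial_iso_total.
- move=> y; have [i j Di Dj|i Di|z mz] :=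
    @partial_iso_total L K I D (fun i => swapped (F i)) cK K0 _ _ y.
  + by have [s|s] := ch i j Di Dj; [left|right] => p /s.
  + exact/partial_iso_swapped/pF.
  + exists z => -[a b] [i Di Fp]; have /= h := mz (b, a) (ex_intro2 _ _ i Di Fp).
    exact: iff_sym.
Qed.

Lemma partial_iso_forth (K L : topologicalType) (r : set (set K * set L))
    (a : set K) :
  parovichenko K -> parovichenko L -> countable r -> partial_iso r ->
  clopen a -> exists b, partial_iso (r `|` [set (a, b)]).
Proof.
move=> pK pL cr [clr tK tL] ca.
(* The filler [(setT, setT)] imposes no condition on a pair of points, so matching becomes equality
   of traces along the enumeration. *)
have [u [ur ru]] := countable_enum (setT, setT) cr.
have clu n : clopen (u n).1 /\ clopen (u n).2.
  by have [/clr//|->] := ru n; split; exact: clopenT.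
have mE z y : matched r z y <->
    trace (fun n => (u n).2) y = trace (fun n => (u n).1) z.
  split=> [m|tE p /ur[n <-]].
    by apply/seteqP; split=> n; rewrite /trace/=; have [/m[]|->] := ru n.
  have : trace (fun n => (u n).2) y n <-> trace (fun n => (u n).1) z n by rewrite tE.
  exact: iff_sym.
have [n|n|z|y|b [cb bK bL]] := @extend_clopen _ _ pK pL
    (fun n => (u n).1) (fun n => (u n).2) _ _ _ _ a ca.
- by have [] := clu n.
- by have [] := clu n.
- by have [y /mE m] := tK z; exists y.
- by have [z /mE m] := tL y; exists z.
exists b; split.
- by move=> p [/clr//|->].
- by move=> z; have [y [/mE m ba]] := bK z; exists y => p [/m//|->]; exact: iff_sym.
- by move=> y; have [z [/esym/mE m ba]] := bL y; exists z => p [/m//|->]; exact: iff_sym.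
Qed.

Lemma partial_iso_back (K L : topologicalType) (r : set (set K * set L))
    (b : set L) :
  parovichenko K -> parovichenko L -> countable r -> partial_iso r ->
  clopen b -> exists a, partial_iso (r `|` [set (a, b)]).
Proof.
move=> pK pL cr pr cb.
have [|a /partial_iso_swapped pa] := partial_iso_forth pL pK _ (partial_iso_swapped pr) cb.
  rewrite (_ : swapped r = (fun p => (p.2, p.1)) @` r); first exact: countable_im.
  by apply/seteqP; split=> [[q1 q2] rq|_ [[q1 q2] rq <-]//]; exists (q2, q1).
exists a; rewrite (_ : _ `|` _ = swapped (swapped r `|` [set (b, a)])) //.
by apply/seteqP; split=> -[q1 q2] [rq|[-> ->]]; by [left|right].
Qed.

(** Only countably many pairs precede each stage of the recursion, so the forth and back steps apply
    there; chains are absorbed by [partial_iso_bigcup]. *)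
Lemma full_partial_iso (CH : continuum_hypothesis) (K L : topologicalType) :
  parovichenko K -> parovichenko L ->
  exists r : set (set K * set L), [/\ partial_iso r,
    forall a, clopen a -> exists b, r (a, b)
  & forall b, clopen b -> exists a, r (a, b)].
Proof.
move=> pK pL.
have [R [[wfR trR totR] cR]] := continuum_well_order CH.
have enum (X : topologicalType) : parovichenko X -> exists g : set nat -> set X,
    (forall s, clopen (g s)) /\ forall C, clopen C -> exists s, g s = C.
  move=> /parovichenko_card[g gP].
  exists (fun s => if pselect (clopen (g s)) then g s else setT); split.
    by move=> s; case: (pselect (clopen (g s))) => [//|nc]; exact: clopenT.
  by move=> C cC; have [s gs] := gP C cC; exists s; rewrite gs; case: pselect.
have [g1 [cg1 sg1]] := enum K pK; have [g2 [cg2 sg2]] := enum L pL.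
(* A stage contributes two pairs: the first provides a partner for [g1 t], the second a partner for
   [g2 t]. *)
pose V := ((set K * set L) * (set K * set L))%type.
pose two (v : V) := [set v.1; v.2].
pose upto (f : set nat -> V) t v :=
  \bigcup_(s in [set s | R s t]) two (f s) `|` two v.
pose Q t f v := [/\ v.1.1 = g1 t, v.2.2 = g2 t & partial_iso (upto f t v)].
have mono f s t : R s t -> upto f s (f s) `<=` upto f t (f t).
  by move=> Rst p [[u Rus up]|ps]; left; [exists u => //; exact: trR Rst|exists s].
have [| |f fQ] := @well_founded_choice _ V ((setT, setT), (setT, setT)) R Q wfR.
- move=> t f g v fg [? ? pv]; split=> //.
  rewrite (_ : upto g t v = upto f t v) //; congr (_ `|` _).
  by apply: eq_bigcupr => s /fg->.
- move=> t f fQ.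
  have pt : partial_iso (\bigcup_(s in [set s | R s t]) two (f s)).
    rewrite (_ : bigcup _ _ = \bigcup_(s in [set s | R s t]) upto f s (f s)).
      apply: partial_iso_bigcup.
      - exact: parovichenko_compact pK.
      - exact: parovichenko_nonempty pK.
      - exact: parovichenko_compact pL.
      - exact: parovichenko_nonempty pL.
      - move=> s s' _ _; have [/mono h|->|/mono h] := totR s s'.
        + by left; exact: h.
        + by left.
        + by right; exact: h.
      - by move=> s /fQ[].
    apply/seteqP; split=> [p [s Rst ps]|p [s Rst [[u Rus pu]|ps]]].
    + by exists s => //; right.
    + by exists u => //; exact: trR Rst.
    + by exists s.
  have ctwo v : countable (two v) by apply: finite_set_countable; exact: finite_set2.
  have ct : countable (\bigcup_(s in [set s | R s t]) two (f s)).
    by apply: bigcup_countable.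
  have [b pb] := partial_iso_forth pK pL ct pt (cg1 t).
  have [|a pa] := partial_iso_back pK pL _ pb (cg2 t).
    by apply: countable_setU => //; exact: countable1.
  exists ((g1 t, b), (a, g2 t)); split=> //.
  by rewrite /upto /two /= setUA.
exists (\bigcup_t two (f t)); split.
- rewrite (_ : bigcup _ _ = \bigcup_t upto f t (f t)).
    apply: partial_iso_bigcup.
    + exact: parovichenko_compact pK.
    + exact: parovichenko_nonempty pK.
    + exact: parovichenko_compact pL.
    + exact: parovichenko_nonempty pL.
    + move=> s s' _ _; have [/mono h|->|/mono h] := totR s s'.
      * by left; exact: h.
      * by left.
      * by right; exact: h.
    + by move=> s _; have [] := fQ s.
  apply/seteqP; split=> [p [s _ ps]|p [s _ [[u Rus pu]|ps]]].
  + by exists s => //; right.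
  + by exists u.
  + by exists s.
- move=> a /sg1[t gt]; have [E _ _] := fQ t.
  by exists (f t).1.2; exists t => //; left; rewrite -gt -E -surjective_pairing.
- move=> a /sg2[t gt]; have [_ E _] := fQ t.
  by exists (f t).2.1; exists t => //; right; rewrite -gt -E -surjective_pairing.
Qed.

(** Every clopen set of [L] occurs in [r]. These sets separate points, so partners are unique, and
    they form a base, so the resulting function is continuous. *)
Lemma matched_function (K L : topologicalType) (r : set (set K * set L)) :
  parovichenko K -> parovichenko L ->  partial_iso r ->
  (forall b, clopen b -> exists a, r (a, b)) ->
  exists2 f : K -> L, continuous f & forall z y, matched r z y <-> y = f z.
Proof.
move=> pK pL [cr /choice[f fP] _] sr.
have funct z y y' : matched r z y -> matched r z y' -> y = y'.
  move=> m m'; apply: contrapT => /(parovichenko_sep pL)[b [/sr[a rab] by_ nby']].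
  by apply: nby'; apply/(m' _ rab)/(m _ rab).
exists f; last first.
  by move=> z y; split=> [m|->]; [exact: funct m (fP z)|exact: fP].
move=> z U /=; rewrite nbhsE => -[W [oW Wz] WU].
have [b [/sr[a rab] bz bW]] := parovichenko_base pL oW Wz.
have ca := (cr _ rab).1.
have : nbhs z a.
  by apply: open_nbhs_nbhs; split; [case: ca|apply/(fP z _ rab)].
by apply: filterS => z' az'; apply/WU/bW/(fP z' _ rab).
Qed.

Theorem parovichenko_homeomorphic (CH : continuum_hypothesis)
    (K L : topologicalType) :
  parovichenko K -> parovichenko L -> homeomorphic K L.
Proof.
move=> pK pL; have [r [pr rK rL]] := full_partial_iso CH pK pL.
have [f cf fP] := matched_function pK pL pr rL.
have [a /rK[b rab]|g cg gP] := matched_function pL pK (partial_iso_swapped pr).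
  by exists b.
have gE z y : matched (swapped r) y z <-> matched r z y.
  by split=> m [p q] /=; [move/(m (q, p))|move/(m (q, p))] => h; exact: iff_sym.
by exists f, g; split => // z; [apply/esym/gP/gE/fP|apply/esym/fP/gE/gP].
Qed.

(** * Collapsing finitely many points *)

Lemma closed_image (Z K : topologicalType) (q : Z -> K) (D : set Z) :
  compact [set: Z] -> hausdorff_space K -> continuous q -> closed D ->
  closed (q @` D).
Proof.
move=> cZ hK cq clD; apply: compact_closed => //.
apply: continuous_compact; first exact: continuous_subspaceT.
exact: subclosed_compact clD cZ _.
Qed.

Section collapse.
Variables (K Z : topologicalType) (q : Z -> K) (x : K).
Hypotheses (pK : parovichenko K) (cZ : compact [set: Z]) (hZ : hausdorff_space Z).
Hypotheses (cq : continuous q) (sq : forall y, exists z, q z = y).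
Hypothesis injq : forall z z', q z = q z' -> q z <> x -> z = z'.
Hypothesis finR : finite_set (q @^-1` [set x]).
Hypothesis denseX : dense (~` (q @^-1` [set x])).

Let hK := parovichenko_hausdorff pK.

Let finite_closed (A : set Z) : finite_set A -> closed A.
Proof.
by move: A; apply/accessible_finite_set_closed; exact: hausdorff_accessible.
Qed.

Lemma clopen_pull (E : set K) : clopen E -> clopen (q @^-1` E).
Proof. by move=> cE; exact: preimage_clopen. Qed.

(** Off the fibre of [x] the map [q] is injective, so the images of [D] and of its complement are
    complementary; both are closed by compactness. *)
Lemma clopen_push (D : set Z) : clopen D -> (forall z, D z -> q z <> x) ->
  clopen (q @` D) /\ forall z, (q @` D) (q z) <-> D z.
Proof.
move=> cD Dx.
have DE z : (q @` D) (q z) <-> D z.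
  split=> [[z' Dz' qz]|Dz]; last by exists z.
  by rewrite -(injq qz (Dx _ Dz')).
have imC : q @` (~` D) = ~` (q @` D).
  apply/seteqP; split=> [_ [z nDz <-] /DE//|y nDy].
  by have [z qz] := sq y; exists z => // Dz; apply: nDy; exists z.
split=> //; split; last by apply: closed_image => //; case: cD.
rewrite -[q @` D]setCK -imC; apply: closed_openC; apply: closed_image => //.
by have [] := clopenC set0 cD.
Qed.

(** Regularity gives [V] around [z] whose closure lies in [U] and has no other point at infinity.
    The image of the boundary of [V] is then a closed set missing [q z]; cutting the closure of [V]
    by the preimage of a clopen [E] that avoids this image removes the boundary. *)
Lemma collapse_base (U : set Z) z : open U -> U z ->
  exists C, [/\ clopen C, C z & C `<=` U].
Proof.
move=> oU Uz; set R := q @^-1` [set x].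
have clR' : closed (R `\` [set z]) by apply: finite_closed; exact: finite_setD.
have oU' : open (U `\` (R `\` [set z])) by apply: openI => //; exact: closed_openC.
have [V Vz VU] : exists2 V, nbhs z V & closure V `<=` U `\` (R `\` [set z]).
  have reg : {for z, regular_space Z}.
    by apply: compact_regular hZ cZ _; exact: filterT.
  have [|V Vz VU] := reg (U `\` (R `\` [set z])); last by exists V.
  by apply: open_nbhs_nbhs; split => //; split => // -[_]; exact.
have clB : closed (closure V `\` V°).
  by apply: closedI; [exact: closed_closure|apply: open_closedC; exact: open_interior].
have [E [cE Ez EB]] : exists E,
    [/\ clopen E, E (q z) & E `<=` ~` (q @` (closure V `\` V°))].
  apply: (parovichenko_base pK); first by apply: closed_openC; exact: closed_image.
  move=> [k [Vk nVk] qk].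
  have [kx|nkx] := pselect (q k = x).
    have [_] := VU k Vk; apply; split=> // kz; apply: nVk.
    by rewrite kz; exact: nbhs_singleton (nbhs_interior Vz).
  by apply: nVk; rewrite (injq qk nkx); exact: nbhs_singleton (nbhs_interior Vz).
exists (q @^-1` E `&` closure V); split.
- have [oE clE] := clopen_pull cE; split.
    rewrite (_ : _ `&` _ = q @^-1` E `&` V°); first exact: openI (open_interior V).
    apply/seteqP; split=> k [Ek Vk]; split=> //.
      by apply: contrapT => nVk; apply: EB Ek _; exists k.
    by apply: subset_closure; exact: interior_subset.
  by apply: closedI => //; exact: closed_closure.
- by split=> //; apply: subset_closure; exact: nbhs_singleton.
- by move=> k [_ /VU[]].
Qed.

(** Local arguments run inside such a [T]: a clopen part of it that misses [z] can be pushed to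
    [K]. *)
Lemma clopen_isolating (z : Z) :
  exists T, [/\ clopen T, T z & forall z', T z' -> q z' = x -> z' = z].
Proof.
have [||T [cT Tz TR]] :=
    @collapse_base (~` (q @^-1` [set x] `\` [set z])) z.
- by apply: closed_openC; apply: finite_closed; exact: finite_setD.
- by move=> [_]; exact.
- exists T; split=> // z' Tz' qz'; apply: contrapT => zz'.
  exact: TR Tz' _.
Qed.

(** By density an isolated point would lie off the fibre of [x], and its image would be isolated in
    [K]. *)
Lemma collapse_perfect (z : Z) : ~ open [set z].
Proof.
move=> oz; have [z' [-> /= qz]] := denseX (ex_intro _ z erefl) oz.
have cz : clopen [set z] by split=> //; exact: closed_point.
have [_ ->//|[oE _] _] := clopen_push cz.
by apply: (parovichenko_perfect pK (z := q z)); rewrite -image_set1.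
Qed.

Section gdelta.
Variable C : nat -> set Z.
Hypotheses (cC : forall n, clopen (C n)) (decC : forall n, C n.+1 `<=` C n).

Lemma gdelta_finite (z : Z) : (forall n, C n z) -> q z <> x ->
  exists D, [/\ clopen D, D !=set0 & forall n, D `<=` C n].
Proof.
move=> Cz qz; have [T [cT Tz TR]] := clopen_isolating z.
have pushE n : clopen (q @` (C n `&` T)) /\
    forall k, (q @` (C n `&` T)) (q k) <-> (C n `&` T) k.
  apply: clopen_push; first exact: clopenI.
  by move=> k [_ Tk] qk; apply: qz; rewrite -(TR k).
have [n|n y|n|D [cD [y Dy] DE]] :=
    parovichenko_gdelta pK (C := fun n => q @` (C n `&` T)).
- by have [] := pushE n.
- by move=> [k [Ck Tk] <-]; exists k => //; split=> //; exact: decC.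
- by exists (q z), z.
- exists (q @^-1` D); split; first exact: clopen_pull.
    by have [k ky] := sq y; exists k; rewrite /= ky.
  by move=> n k /= /DE/(pushE n).2[].
Qed.

(* Inside [T], the sets [C n] shrink to [z], so the clopen sets [A n] of [K]
   increase strictly and every clopen set disjoint from [x] meets only finitely
   many of the differences [E n].  Splitting each [E n] in two yields disjoint
   open F_sigma sets that both accumulate at [x]. *)
Lemma gdelta_infinity (z : Z) : (forall n, C n z) ->
  (forall k, (forall n, C n k) -> q k = x) -> False.
Proof.
move=> Cz Cx; have [T [cT Tz TR]] := clopen_isolating z.
have pushE n : clopen (q @` (T `\` C n)) /\
    forall k, (q @` (T `\` C n)) (q k) <-> (T `\` C n) k.
  apply: clopen_push; first exact: clopenD.
  by move=> k [Tk nCk] qk; apply: nCk; rewrite (TR k).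
pose A n := q @` (T `\` C n); pose E n := A n.+1 `\` A n.
have Aq n k : A n (q k) <-> (T `\` C n) k by exact: (pushE n).2.
have cE n : clopen (E n) by apply: clopenD; exact: (pushE _).1.
have decC' := decreasing_subset decC.
(* If all [E n] with [N <= n] were empty, [T] and [C N] would meet in [z] alone, which would be
   isolated. *)
have Efar N : exists2 n, N <= n & E n !=set0.
  apply: contrapT => nE; apply: (@collapse_perfect z).
  rewrite (_ : [set z] = T `&` C N); first by apply: openI; [case: cT|case: (cC N)].
  apply/seteqP; split=> [_ ->//|k [Tk CNk]] /=; apply: TR => //; apply: Cx => n.
  have [Nn|/ltnW/decC'] := leqP N n; last by apply.
  elim: n Nn => [|n IH]; first by rewrite leqn0 => /eqP <-.
  rewrite leq_eqVlt => /predU1P[<-//|]; rewrite ltnS => Nn.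
  apply: contrapT => nC; apply: nE; exists n => //; exists (q k); split; apply/Aq => //.
  by move=> [_]; apply; exact: IH.
(* By compactness the preimage of [S] misses [C N] inside [T] for some [N], whereas the points of
   [E m] with [N <= m] come from [C N]. *)
have noS (W : nat -> set K) (S : set K) : clopen S -> ~ S x ->
    (forall n, W n `<=` E n) -> (forall n, E n !=set0 -> W n !=set0) ->
    (forall n, W n `<=` S) -> False.
  move=> cS nSx WE W0 WS.
  have [N N0] : exists N, ~ ((C N `&` (T `&` q @^-1` S)) !=set0).
    apply/existsNP => all0.
    have [|n|n k [Ck Tk]|//|k Ck] :=
      @compact_decreasing _ (fun N => C N `&` (T `&` q @^-1` S)).
    - exact: cZ.
    - by apply: closedI; [case: (cC n)|apply: closedI; [case: cT|case: (clopen_pull cS)]].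
    - by split => //; exact: decC.
    - have [_ [_ /=]] := Ck 0; rewrite Cx // => n; by case: (Ck n).
  have [m Nm /W0[y Wy]] := Efar N.
  have [k ky] := sq y; apply: N0; exists k.
  have := WE _ _ Wy; rewrite -ky => -[/Aq[Tk _] nAk].
  split; last by split => //=; rewrite ky; exact: WS Wy.
  by apply: (decC' _ _ Nm); apply: contrapT => nC; apply/nAk/Aq.
have /choice[P PP] : forall n, exists P, [/\ clopen P, P `<=` E n,
    E n !=set0 -> P !=set0 & E n !=set0 -> (E n `\` P) !=set0].
  move=> n; have [En|nEn] := pselect (E n !=set0); last first.
    by exists set0; split=> //; exact: clopen0.
  have [D0 [D1 [[? _] [? [y D1y]] [? DE] dis]]] := parovichenko_split pK (cE n) En.
  exists D0; split=> // _; exists y; split; first exact: DE.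
  by move=> D0y; have : (D0 `&` D1) y by []; rewrite dis.
have Emono m n y : m < n -> E m y -> ~ E n y.
  move=> mn; have [k <-] := sq y => -[/Aq[Tk nCk] _] [_]; apply; apply/Aq.
  by split=> // Cn; apply: nCk; exact: decC' Cn.
have [| |B [n _ <-]|B [n _ <-]|A' B' [m _ <-] [n _ <-]|S [cS PS QS]] :=
    parovichenko_separation pK (F := range P) (G := range (fun n => E n `\` P n)).
- exact: countable_im.
- exact: countable_im.
- by have [] := PP n.
- by apply: clopenD => //; have [] := PP n.
- apply/seteqP; split => // y [Py [Ey nPy]].
  have [_ PE _ _] := PP m; have Emy := PE _ Py.
  have [mn|nm|mn] := ltngtP m n; first exact: (Emono m n y).
    exact: (Emono n m y).
  by subst n.
have [Sx|nSx] := pselect (S x).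
  apply: (noS (fun n => E n `\` P n) (~` S)) => //.
  + exact: clopenC.
  + by move=> n; have [_ _ _] := PP n; apply.
  + by move=> n; apply: QS; exists n.
apply: (noS P S) => //.
+ by move=> n; have [] := PP n.
+ by move=> n; have [_ _ + _] := PP n; apply.
+ by move=> n; apply: PS; exists n.
Qed.

End gdelta.

Lemma collapse_gdelta (C : nat -> set Z) :
  (forall n, clopen (C n)) -> (forall n, C n.+1 `<=` C n) ->
  (forall n, C n !=set0) ->
  exists D, [/\ clopen D, D !=set0 & forall n, D `<=` C n].
Proof.
move=> cC decC C0.
have [z Cz] := compact_decreasing cZ (fun n => (cC n).2) decC C0.
have [[k [Ck qk]]|nk] := pselect (exists k, (forall n, C n k) /\ q k <> x).
  exact: gdelta_finite Ck qk.
exfalso; apply: (gdelta_infinity cC decC Cz) => k Ck.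
by apply: contrapT => qk; apply: nk; exists k.
Qed.

(** Separation is a local matter by [clopen_induction]. Near a point of some member of [F] or [G]
    that member decides; near any other point the traces of all members on an isolating [T] are
    pushed to [K] and separated there. *)
Lemma collapse_separation (F G : set (set Z)) :
  countable F -> countable G -> F `<=` clopen -> G `<=` clopen ->
  (forall A B, F A -> G B -> A `&` B = set0) ->
  exists S, [/\ clopen S, forall A, F A -> A `<=` S
              & forall B, G B -> B `<=` ~` S].
Proof.
move=> cF cG clF clG FG.
pose P T := clopen T /\ exists S, [/\ clopen S, forall A, F A -> A `&` T `<=` S
              & forall B, G B -> B `&` T `<=` ~` S].
suff [_ [S [cS FS GS]]] : P setT.
  by exists S; split=> // A; [move=> /FS|move=> /GS]; rewrite setIT.
apply: clopen_induction => //.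
- split; first exact: clopen0.
  by exists set0; split; [exact: clopen0| |] => A _; rewrite setI0.
- move=> T1 T2 [cT1 [S1 [cS1 F1 G1]]] [cT2 [S2 [cS2 F2 G2]]].
  split; first exact: clopenU.
  exists ((S1 `&` T1) `|` (S2 `\` T1)); split.
  + by apply: clopenU; [exact: clopenI|exact: clopenD].
  + move=> A FA z [Az T12].
    have [T1z|nT1z] := pselect (T1 z); first by left; split=> //; apply: (F1 A).
    by right; split=> //; apply: (F2 A FA); split=> //; case: T12.
  + move=> B GB z [Bz T12] [[S1z T1z]|[S2z nT1z]]; first exact: (G1 B GB z).
    by apply: (G2 B GB z) => //; split=> //; case: T12.
- move=> z.
  have [[A [FA Az]]|nF] := pselect (exists A, F A /\ A z).
    exists A; split=> //; first exact: clF.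
    split; first exact: clF.
    exists A; split; [exact: clF|by move=> B _ y []|].
    move=> B GB y [By Ay] _; have : (A `&` B) y by [].
    by rewrite (FG A B).
  have [[B [GB Bz]]|nG] := pselect (exists B, G B /\ B z).
    exists B; split=> //; first exact: clG.
    split; first exact: clG.
    exists set0; split; [exact: clopen0| |by move=> ? _ y _].
    move=> A FA y Ay; by rewrite -(FG A B).
  have [T [cT Tz TR]] := clopen_isolating z.
  exists T; split=> //; split=> //.
  have pushE A : clopen A -> ~ A z -> clopen (q @` (A `&` T)) /\
      forall k, (q @` (A `&` T)) (q k) <-> (A `&` T) k.
    move=> cA nAz; apply: clopen_push; first exact: clopenI.
    by move=> k [Ak Tk] /(TR k Tk) kz; apply: nAz; rewrite -kz.
  have pF A : F A -> clopen (q @` (A `&` T)) /\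
      forall k, (q @` (A `&` T)) (q k) <-> (A `&` T) k.
    by move=> FA; apply: pushE; [exact: clF|move=> Az; apply: nF; exists A].
  have pG A : G A -> clopen (q @` (A `&` T)) /\
      forall k, (q @` (A `&` T)) (q k) <-> (A `&` T) k.
    by move=> GA; apply: pushE; [exact: clG|move=> Az; apply: nG; exists A].
  have [| |_ [A FA <-]|_ [B GB <-]|_ _ [A FA <-] [B GB <-]|S [cS FS GS]] :=
    parovichenko_separation pK (F := (fun A => q @` (A `&` T)) @` F)
      (G := (fun A => q @` (A `&` T)) @` G).
  + exact: countable_im.
  + exact: countable_im.
  + by have [] := pF A FA.
  + by have [] := pG B GB.
  + apply/seteqP; split=> // y; have [k <-] := sq y.
    move=> [/(pF A FA).2[Ak _] /(pG B GB).2[Bk _]].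
    by have : (A `&` B) k by []; rewrite FG.
  + exists (q @^-1` S); split; first exact: clopen_pull.
      by move=> A FA k ATk; apply: (FS (q @` (A `&` T))); [exists A|exists k].
    by move=> B GB k BTk; apply: (GS (q @` (B `&` T))); [exists B|exists k].
Qed.

Lemma collapse_card : exists g : set nat -> set Z,
  forall C, clopen C -> exists s, g s = C.
Proof.
have [gK gKP] := parovichenko_card pK.
pose P T := clopen T /\ exists g : set nat -> set Z,
  forall C, clopen C -> exists s, g s = C `&` T.
suff [_ [g gP]] : P setT.
  by exists g => C /gP[s gs]; exists s; rewrite gs setIT.
apply: clopen_induction => //.
- by split; [exact: clopen0|exists (fun=> set0) => C _; exists set0; rewrite setI0].
- move=> T1 T2 [cT1 [g1 g1P]] [cT2 [g2 g2P]]; split; first exact: clopenU.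
  (* The even and the odd numbers carry one code each. *)
  exists (fun s => g1 [set n | s n.*2] `|` g2 [set n | s n.*2.+1]) => C cC.
  have [s1 s1C] := g1P C cC; have [s2 s2C] := g2P C cC.
  exists [set n | if odd n then s2 n./2 else s1 n./2].
  rewrite setIUr -s1C -s2C; congr (g1 _ `|` g2 _); apply/seteqP.
    by split=> n /=; rewrite odd_double doubleK.
  by split=> n /=; rewrite odd_double /= uphalf_double.
- move=> z; have [T [cT Tz TR]] := clopen_isolating z.
  exists T; split=> //; split=> //.
  (* Membership of [0] tells whether the rest of [s] codes the trace on [T] or its complement in
     [T]; only the one that misses [z] comes from a clopen set of [K]. *)
  exists (fun s => if `[< s 0 >] then T `\` q @^-1` (gK [set n | s n.+1])
                   else q @^-1` (gK [set n | s n.+1])) => C cC.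
  have [D [cD DT nDz DC]] : exists D, [/\ clopen D, D `<=` T, ~ D z &
      C `&` T = D \/ C `&` T = T `\` D].
    have [Cz|nCz] := pselect (C z).
      exists (T `\` C); split; [exact: clopenD|by move=> y []|by move=> []|right].
      by rewrite setDD setIC.
    by exists (C `&` T); split; [exact: clopenI|by move=> y []|by move=> []|left].
  have [|k Dk qk|cqD qD] := clopen_push (D := D) => //.
    by apply: nDz; rewrite -(TR k) //; exact: DT.
  have [s gs] := gKP _ cqD.
  have DE : q @^-1` (gK s) = D by rewrite gs; apply/seteqP; split=> k /qD.
  case: DC => ->.
    exists [set n | if n is m.+1 then s m else False].
    by rewrite asboolF //= -DE.
  exists [set n | if n is m.+1 then s m else True].
  by rewrite asboolT //= -DE.
Qed.

Lemma collapse_parovichenko : parovichenko Z.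
Proof.
split=> //.
- exact: collapse_base.
- by have [y _] := parovichenko_nonempty pK; have [z _] := sq y; exists z.
- exact: collapse_perfect.
- exact: collapse_gdelta.
- exact: collapse_separation.
- exact: collapse_card.
Qed.

(* Disjoint clopen neighbourhoods of two points at infinity would otherwise
   contain disjoint countable unions of clopen sets of [K], both accumulating
   at [x]. *)
Lemma collapse_P_point (z1 z2 : Z) : q z1 = x -> q z2 = x -> z1 <> z2 ->
  ~ P_point z1 -> P_point z2.
Proof.
move=> qz1 qz2 z12 nP U2 U2z.
move: nP => /existsNP[U1 /not_implyP[U1z nU1]].
apply: contrapT => nU2.
have [T1 [cT1 T1z T1R]] := clopen_isolating z1.
have [T2' [cT2' T2z' T2R']] := clopen_isolating z2.
pose T2 := T2' `\` T1.
have cT2 : clopen T2 by exact: clopenD.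
have T2z : T2 z2 by split=> // /T1R/(_ qz2)/esym.
have T2R z : T2 z -> q z = x -> z = z2 by move=> [/T2R'].
(* Each [U n] is shrunk to a clopen [C n] around [z]; what it leaves of [T] misses the fibre of [x]
   and is pushed to [K]. *)
have small z T (U : nat -> set Z) : clopen T -> T z ->
    (forall z', T z' -> q z' = x -> z' = z) -> (forall n, nbhs z (U n)) ->
    exists C : nat -> set Z, forall n, [/\ C n `<=` U n,
      clopen (q @` (T `\` C n)) &
      forall k, (q @` (T `\` C n)) (q k) <-> (T `\` C n) k].
  move=> cT Tz TR Uz.
  suff /choice[C CP] : forall n, exists C,  [/\ C `<=` U n,
      clopen (q @` (T `\` C)) &
      forall k, (q @` (T `\` C)) (q k) <-> (T `\` C) k] by exists C.
  move=> n; have := Uz n; rewrite nbhsE => -[V [oV Vz] VU].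
  have [C [cC Cz CV]] := collapse_base oV Vz.
  have [| |? ?] := clopen_push (D := T `\` C).
  - exact: clopenD.
  - by move=> k [Tk nCk] qk; apply: nCk; rewrite (TR k).
  - by exists C; split=> //; exact: subset_trans VU.
have [C1 C1P] := small z1 T1 U1 cT1 T1z T1R U1z.
have [C2 C2P] := small z2 T2 U2 cT2 T2z T2R U2z.
have [| |_ [n _ <-]|_ [n _ <-]|_ _ [m _ <-] [n _ <-]|S [cS FS GS]] :=
  parovichenko_separation pK (F := range (fun n => q @` (T1 `\` C1 n)))
    (G := range (fun n => q @` (T2 `\` C2 n))).
- exact: countable_im.
- exact: countable_im.
- by have [] := C1P n.
- by have [] := C2P n.
- apply/seteqP; split=> // y; have [k <-] := sq y.
  have [_ _ h1] := C1P m; have [_ _ h2] := C2P n.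
  by move=> [/h1[T1k _] /h2[[_ nT1k] _]].
(* The side of [S] containing [x] pulls back, within [T2] or [T1], to a neighbourhood lying in every
   [C2 n] or every [C1 n]. *)
have [Sx|nSx] := pselect (S x).
  apply: nU2; have : nbhs z2 (q @^-1` S `&` T2).
    apply: open_nbhs_nbhs; split; last by split=> //=; rewrite qz2.
    by apply: openI; [case: (clopen_pull cS)|case: cT2].
  apply: filterS => k [/= Sk T2k] n _; have [CU _ _] := C2P n.
  apply: CU; apply: contrapT => nCk.
  by apply: (GS (q @` (T2 `\` C2 n)) _ (q k) _ Sk); [exists n|exists k].
apply: nU1; have : nbhs z1 (q @^-1` (~` S) `&` T1).
  apply: open_nbhs_nbhs; split; last by split=> //=; rewrite qz1.
  by apply: openI; [case: (clopen_pull (clopenC set0 cS))|case: cT1].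
apply: filterS => k [/= nSk T1k] n _; have [CU _ _] := C1P n.
apply: CU; apply: contrapT => nCk; apply: nSk.
by apply: (FS (q @` (T1 `\` C1 n)) _ (q k)); [exists n|exists k].
Qed.

End collapse.

(** * The collapsing map of a finite compactification *)

Lemma embedding_continuous (X Z : topologicalType) (j : X -> Z) :
  embedding j -> continuous j.
Proof. by move=> [_ ej]; apply/continuousP => V oV; apply/ej; exists V. Qed.

Lemma embedding_compact (X Z : topologicalType) (j : X -> Z) (C : set Z) :
  embedding j -> compact C -> C `<=` range j -> compact (j @^-1` C).
Proof.
move=> [_ ej] cC Cj F PF FC.
have [c [Cc clc]] : C `&` cluster (j @ F) !=set0 by exact: cC.
have [y _ yc] := Cj _ Cc; exists y; split; first by rewrite /= yc.
move=> A B FA; rewrite nbhsE => -[U [oU Uy] UB].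
have [V oV VU] := (ej U).1 oU.
have [||_ [[a Aa <-] Va]] := clc (j @` A) V.
- by suff : F (j @^-1` (j @` A)) by []; apply: filterS FA => a Aa; exists a.
- by apply: open_nbhs_nbhs; split=> //; rewrite -yc; move: Uy; rewrite -VU.
- by exists a; split=> //; apply: UB; rewrite -VU.
Qed.

Section collapse_map.
Variables (X K Z : topologicalType) (i : X -> K) (j : X -> Z) (x : K).
Hypotheses (pK : parovichenko K) (ei : embedding i) (ri : range i = ~` [set x]).
Hypothesis fj : finite_compactification j.

Let cZ : compact [set: Z]. Proof. by case: fj => -[]. Qed.
Let hZ : hausdorff_space Z. Proof. by case: fj => -[]. Qed.
Let ej : embedding j. Proof. by case: fj => -[]. Qed.
Let dj : dense (range j). Proof. by case: fj => -[]. Qed.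
Let finr : finite_set (remainder j). Proof. by case: fj. Qed.

(** Openness passes to [Z] because the finite remainder is closed, and closedness because a closed
    set missing [x] is compact in [X]. *)
Lemma clopen_transfer (C : set K) : clopen C -> ~ C x ->
  clopen (j @` (i @^-1` C)).
Proof.
move=> [oC clC] nCx; split.
  have [V oV VC] : exists2 V : set Z, open V & j @^-1` V = i @^-1` C.
    by apply/(proj2 ej)/(proj2 ei); exists C.
  have -> : j @` (i @^-1` C) = V `&` range j.
    rewrite -VC; apply/seteqP; split=> [_ [a Va <-]|z [+ [a _ az]]].
      by split=> //; exists a.
    by rewrite -az => Va; exists a.
  apply: openI => //; rewrite -[range j]setCK; apply: closed_openC.
  by apply: (accessible_finite_set_closed.1 (hausdorff_accessible hZ)).
apply: compact_closed => //; apply: continuous_compact.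
  by apply: continuous_subspaceT; exact: embedding_continuous.
apply: embedding_compact => //.
  by apply: (subclosed_compact clC (parovichenko_compact pK)).
by move=> y Cy; rewrite ri => yx; apply: nCx; rewrite -yx.
Qed.

(** Otherwise [X] is compact, its image in [K] is closed, and [x] is isolated. *)
Lemma remainder_nonempty : remainder j !=set0.
Proof.
apply: contrapT => /set0P/negP; rewrite negbK => /eqP r0.
apply: (parovichenko_perfect pK (z := x)).
rewrite -[[set x]]setCK -ri; apply: closed_openC.
apply: compact_closed; first exact: parovichenko_hausdorff pK.
apply: continuous_compact.
  by apply: continuous_subspaceT; exact: embedding_continuous.
rewrite -(preimage_setT j); apply: embedding_compact => //.
by rewrite -[range j]setCK -/(remainder j) r0 setC0.
Qed.

(** The map [q] is [i] on [X] and [x] on the remainder. Continuity is tested on clopen sets, passing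
    to the complement when they contain [x]. *)
Lemma collapse_map_ex : exists q : Z -> K, [/\ continuous q,
  forall y, exists z, q z = y,
  forall z z', q z = q z' -> q z <> x -> z = z' &
  q @^-1` [set x] = remainder j].
Proof.
have /choice[q qP] : forall z, exists y,
    (forall a, j a = z -> i a = y) /\ (remainder j z -> y = x).
  move=> z; have [[a _ az]|nz] := pselect (range j z).
    by exists (i a); split=> [b bz|[]]; [congr i; apply: ej.1; rewrite az|exists a].
  by exists x; split=> // a az; case: nz; exists a.
have qj a : q (j a) = i a by have [h _] := qP (j a); rewrite (h a).
have qr z : remainder j z -> q z = x by have [_] := qP z.
have qx a : i a <> x by move=> ax; have : range i x by [exists a]; rewrite ri; exact.
have qE z : q z <> x -> exists a, z = j a.
  by move=> nz; apply: contrapT => nj; apply/nz/qr => -[a _ az]; apply: nj; exists a.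
have pre (C : set K) : ~ C x -> q @^-1` C = j @` (i @^-1` C).
  move=> nCx; apply/seteqP; split=> [z Cz|_ [a Ca <-]]; last by rewrite /= qj.
  have [a za] : exists a, z = j a by apply: qE => zx; apply: nCx; rewrite -zx.
  by exists a => //=; rewrite -qj -za.
exists q; split.
- move=> z U /=; rewrite nbhsE => -[W [oW Wz] WU].
  have [C [cC Cz CW]] := parovichenko_base pK oW Wz.
  have cq : clopen (q @^-1` C).
    have [Cx|nCx] := pselect (C x); last by rewrite pre //; exact: clopen_transfer.
    rewrite -[_ @^-1` _]setCK preimage_setC pre; last by exact.
    by apply: (clopenC set0); apply: clopen_transfer; [exact: (clopenC set0)|exact].
  have : nbhs z (q @^-1` C) by apply: open_nbhs_nbhs; split => //; case: cq.
  by apply: filterS => k /CW/WU.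
- move=> y; have [->|/eqP yx] := eqVneq y x.
    by have [z /qr qz] := remainder_nonempty; exists z.
  have [a _ ay] : range i y by rewrite ri.
  by exists (j a); rewrite qj.
- move=> z z' qzz' qz; have [a za] := qE z qz.
  have [a' za'] : exists a, z' = j a by apply: qE; rewrite -qzz'.
  by move: qzz'; rewrite za za' !qj => /ei.1->.
- apply/seteqP; split=> z /=; last exact: qr.
  by move=> qz [a _ az]; apply: (qx a); rewrite -qj az.
Qed.

Lemma finite_compactification_parovichenko : parovichenko Z.
Proof.
have [q [cq sq iq qr]] := collapse_map_ex.
apply: (collapse_parovichenko pK cZ hZ cq sq iq); first by rewrite qr.
by rewrite qr /remainder setCK.
Qed.

Lemma finite_compactification_P_point : is_subset1 (remainder j `\` @P_point Z).
Proof.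
have [q [cq sq iq qr]] := collapse_map_ex.
move=> z1 z2 [r1 n1] [r2 n2]; apply: contrapT => z12; apply: n2.
apply: (collapse_P_point pK cZ hZ cq sq iq _ _ _ z12 n1); first by rewrite qr.
  by move: r1; rewrite -qr.
by move: r2; rewrite -qr.
Qed.

End collapse_map.

(** * Compactifications with many points at infinity *)

Section colouring.
Variables (K : topologicalType) (pK : parovichenko K).

(** Split repeatedly, keeping the first half as [E n] and continuing in the second. *)
Lemma disjoint_clopens (D : set K) : clopen D -> D !=set0 ->
  exists E : nat -> set K,
    [/\ forall n, clopen (E n), forall n, E n !=set0, forall n, E n `<=` D
      & forall m n z, E m z -> E n z -> m = n].
Proof.
move=> cD D0.
have /choice[h hP] : forall D, exists p : set K * set K, clopen D -> D !=set0 ->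
    [/\ clopen p.1 /\ clopen p.2, p.1 !=set0 /\ p.2 !=set0,
    p.1 `<=` D /\ p.2 `<=` D & p.1 `&` p.2 = set0].
  move=> A; have [[cA A0]|nA] := pselect (clopen A /\ A !=set0).
    by have [D1 [D2 DP]] := parovichenko_split pK cA A0; exists (D1, D2).
  by exists (set0, set0) => cA A0; case: nA.
pose r n := iter n (fun A => (h A).2) D.
have rP n : clopen (r n) /\ r n !=set0.
  elim: n => [//|n [c0 n0]]; have [[_ ?] [_ ?] _ _] := hP _ c0 n0.
  by split.
have hrP n := hP (r n) (rP n).1 (rP n).2.
have rdec : forall n, r n.+1 `<=` r n by move=> n; have [_ _ [_ ?] _] := hrP n.
have rsub := decreasing_subset rdec.
have hsub n : (h (r n)).1 `<=` r n by have [_ _ [? _] _] := hrP n.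
have hlt m n z : m < n -> (h (r m)).1 z -> ~ (h (r n)).1 z.
  move=> mn hm /hsub/(rsub _ _ mn) hn; have [_ _ _ dis] := hrP m.
  by have : ((h (r m)).1 `&` (h (r m)).2) z by []; rewrite dis.
exists (fun n => (h (r n)).1); split.
- by move=> n; have [[? _] _ _ _] := hrP n.
- by move=> n; have [_ [? _] _ _] := hrP n.
- by move=> n; apply: subset_trans (hsub n) (rsub 0 n _).
- move=> m n z hm hn; have [mn|nm|//] := ltngtP m n; exfalso.
    exact: hlt mn hm hn.
  exact: hlt nm hn hm.
Qed.

(** The points outside all members of [F] form a G_delta set containing [x], so it has interior; of
    two disjoint halves of a clopen set therein, one misses [x]. *)
Lemma clopen_avoiding (x : K) (F : set (set K)) : countable F ->
  (forall A, F A -> clopen A /\ ~ A x) ->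
  exists D, [/\ clopen D, D !=set0, ~ D x & forall A, F A -> D `&` A = set0].
Proof.
move=> cF FP; have [u [uF Fu]] := countable_enum set0 cF.
have uP n : clopen (u n) /\ ~ u n x.
  by have [/FP//|->] := Fu n; split=> //; exact: clopen0.
have [n|n z h k kn|n|D [cD D0 DC]] :=
    parovichenko_gdelta pK (C := fun n => [set z | forall k, k < n -> ~ u k z]).
- elim: n => [|n IH].
    by rewrite (_ : mkset _ = setT); [exact: clopenT|apply/seteqP].
  rewrite (_ : mkset _ = [set z | forall k, k < n -> ~ u k z] `\` u n).
    by apply: clopenD => //; have [] := uP n.
  apply/seteqP; split=> [z h|z [h nu] k].
    by split=> [k kn|]; apply: h => //; rewrite ltnS ltnW.
  by rewrite ltnS leq_eqVlt => /predU1P[->//|]; exact: h.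
- by apply: h; rewrite ltnS ltnW.
- by exists x => k _; have [] := uP k.
- have avoid A : F A -> D `&` A = set0.
    move=> /uF[n <-]; apply/seteqP; split=> // z [Dz uz].
    exact: DC n.+1 z Dz n (ltnSn n) uz.
  have [D1 [D2 [[c1 c2] [n1 n2] [s1 s2] dis]]] := parovichenko_split pK cD D0.
  have av E A : E `<=` D -> F A -> E `&` A = set0.
    by move=> ED /avoid DA; apply/seteqP; split=> // z [/ED Ez Az]; rewrite -DA.
  have [D1x|nD1x] := pselect (D1 x).
    exists D2; split=> //; last by move=> A; exact: av.
    by move=> D2x; have : (D1 `&` D2) x by []; rewrite dis.
  by exists D1; split=> // A; exact: av.
Qed.

(* Stage [t] colours a clopen set missing [x] that contains the [t]-th such set,
   coherently with all earlier stages, and also a fresh clopen set on which every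
   colour occurs.  Only agreement on common domains is required, so the F-space
   property suffices at every stage and [x] need not be a P-point. *)
Lemma coherent_colouring (CH : continuum_hypothesis) (x : K) :
  exists U : nat -> set K,
    (forall y, y <> x -> exists B A, [/\ clopen B, B y & forall i : nat,
       clopen (A i) /\ forall z, B z -> (U i z <-> A i z)]) /\
    (forall W i, clopen W -> W x ->
       exists y, [/\ W y, y <> x & forall i', U i' y <-> i' = i]).
Proof.
have [R [[wfR trR totR] cR]] := continuum_well_order CH.
have [g0 g0P] := parovichenko_card pK.
have [g [gP sg]] : exists g : set nat -> set K, (forall s, clopen (g s) /\ ~ g s x) /\
    forall C, clopen C -> ~ C x -> exists s, g s = C.
  exists (fun s => if pselect (clopen (g0 s) /\ ~ g0 s x) then g0 s else set0).
  split=> [s|C cC nCx].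
    case: (pselect (clopen (g0 s) /\ ~ g0 s x)) => [//|n].
    by split=> //; exact: clopen0.
  have [s gs] := g0P C cC; exists s; rewrite gs.
  by case: (pselect (clopen C /\ ~ C x)) => // -[].
(* A stage consists of a clopen domain [v.2] and the colour classes [v.1 i], which matter only on
   that domain. *)
pose V := ((nat -> set K) * set K)%type.
pose Q t (f : set nat -> V) (v : V) := [/\
  [/\ clopen v.2, ~ v.2 x & g t `<=` v.2],
  forall i, clopen (v.1 i),
  forall s, R s t -> forall i y, v.2 y -> (f s).2 y -> (v.1 i y <-> (f s).1 i y) &
  forall i, exists y, [/\ v.2 y, ~ g t y & forall i', v.1 i' y <-> i' = i]].
have [|t f fQ|f fQ] := @well_founded_choice _ V (fun=> set0, set0) R Q wfR.
- move=> t f f' v ff' [? ? h ?]; split=> // s Rst; rewrite -ff' //; exact: h.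
- have coh s s' i y : R s t -> R s' t -> (f s).2 y -> (f s').2 y ->
      (f s).1 i y <-> (f s').1 i y.
    move=> Rst Rs't; have [Rss'|->//|Rs's] := totR s s'.
      move=> sy s'y; apply: iff_sym; have [_ _ h _] := fQ _ Rs't.
      exact: h.
    by move=> sy s'y; have [_ _ h _] := fQ _ Rst; exact: h.
  have ctm (F : set nat -> set K) : countable (F @` [set s | R s t]).
    exact: countable_im.
  (* [S i] interpolates colour [i] of all earlier stages; their agreement on common domains makes
     the sets to be separated disjoint. *)
  have /choice[S SP] : forall i, exists S, clopen S /\
      forall s y, R s t -> (f s).2 y -> (S y <-> (f s).1 i y).
    move=> i; have [| |_ [s Rst <-]|_ [s Rst <-]|_ _ [s Rst <-] [s' Rs't <-]|S [cS FS GS]] :=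
      parovichenko_separation pK
        (F := (fun s => (f s).2 `&` (f s).1 i) @` [set s | R s t])
        (G := (fun s => (f s).2 `\` (f s).1 i) @` [set s | R s t]).
    + exact: ctm.
    + exact: ctm.
    + by have [[? _ _] ? _ _] := fQ _ Rst; exact: clopenI.
    + by have [[? _ _] ? _ _] := fQ _ Rst; exact: clopenD.
    + apply/seteqP; split=> // y [[sy ay] [s'y nay]]; apply: nay.
      exact/(coh s).
    + exists S; split=> // s y Rst sy; split=> [Sy|ay].
        apply: contrapT => nay; apply: (GS ((f s).2 `\` (f s).1 i) _ y) => //.
        by exists s.
      by apply: (FS ((f s).2 `&` (f s).1 i)) => //; exists s.
  have [||D [cD D0 nDx Dav]] := @clopen_avoiding x
      ([set g t] `|` (fun s => (f s).2) @` [set s | R s t]).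
  + by apply: countable_setU => //; exact: countable1.
  + move=> A [->|[s Rst <-]]; first exact: gP.
    by have [[? ? _] _ _ _] := fQ _ Rst.
  + have [E [cE E0 ED Einj]] := disjoint_clopens cD D0.
    have nDg y : D y -> ~ g t y.
      by move=> Dy gy; rewrite -[False]/(set0 y) -(Dav (g t)) //; left.
    (* The fresh set [D] misses [g t] and all earlier domains, so recolouring it by the [E i]
       disturbs nothing. *)
    exists (fun i => (S i `\` D) `|` E i, g t `|` D); split=> /=.
    * have [cg ngx] := gP t; split; [exact: clopenU|by case|].
      by move=> y gy; left.
    * by move=> i; apply: clopenU => //; apply: clopenD => //; have [] := SP i.
    * move=> s Rst i y _ sy.
      have nDy : ~ D y.
        move=> Dy; rewrite -[False]/(set0 y) -(Dav (f s).2) //.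
        by right; exists s.
      have [_ h] := SP i; have := h s y Rst sy => hS.
      by split=> [[[/hS]//|/ED]//|/hS]; left.
    * move=> i; have [y Ey] := E0 i; exists y; split; first by right; exact: ED Ey.
        by apply: nDg; exact: ED Ey.
      move=> i'; split=> [[[_ []]|E'y]|->]; last by right.
        exact: ED Ey.
      exact: Einj E'y Ey.
- pose U i := [set y | exists t, (f t).2 y /\ (f t).1 i y].
  have UE t i y : (f t).2 y -> (U i y <-> (f t).1 i y).
    move=> ty; split=> [[s [sy ay]]|ay]; last by exists t.
    have [Rst|<-//|Rts] := totR s t.
      by have [_ _ h _] := fQ t; apply/(h _ Rst).
    by have [_ _ h _] := fQ s; apply/(h _ Rts).
  exists U; split.
    move=> y yx; have [C [cC Cy nCx]] := parovichenko_sep pK yx.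
    have [t gt] := sg C cC nCx; have [[cB _ gB] cA _ _] := fQ t.
    exists (f t).2, (f t).1; split=> //; first by apply: gB; rewrite gt.
    by move=> i; split=> // z; exact: UE.
  (* At the stage that handles the complement of [W], the fresh points lie in [W], differ from [x]
     and have every colour. *)
  move=> W i cW Wx; have [||t gt] := sg (~` W).
  + exact: (clopenC set0).
  + exact.
  + have [[_ nBx _] _ _ h] := fQ t; have [y [By ngy Ay]] := h i.
    exists y; split.
    * by apply: contrapT => nWy; apply: ngy; rewrite gt.
    * by move=> yx; apply: nBx; rewrite -yx.
    * by move=> i'; split=> [/(UE _ _ _ By)/Ay|/Ay/(UE _ _ _ By)].
Qed.

End colouring.

(** * Subspaces, products and the compactification given by a colouring *)

Lemma cluster_hausdorff (X Y : topologicalType) (f : X -> Y) (p q : X) :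
  continuous f -> hausdorff_space Y -> cluster (nbhs p) q -> f p = f q.
Proof.
move=> cf hY clq; apply: hY => A B /cf fA /cf fB.
by have [z [? ?]] := clq _ _ fA fB; exists (f z).
Qed.

Lemma set_val_continuous (T : topologicalType) (A : set T) :
  continuous (set_val : set_type A -> T).
Proof. exact: initial_continuous. Qed.

Lemma set_type_open (T : topologicalType) (A : set T) (U : set (set_type A)) :
  open U <-> exists2 V : set T, open V & set_val @^-1` V = U.
Proof. by []. Qed.

Lemma set_type_embedding (T : topologicalType) (A : set T) :
  embedding (set_val : set_type A -> T).
Proof. by split=> //; exact: val_inj. Qed.

Lemma range_set_val (T : Type) (A : set T) :
  range (set_val : set_type A -> T) = A.
Proof.
apply/seteqP; split=> [_ [a _ <-]|a Aa]; first exact: set_valP.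
by exists (exist _ a (mem_set Aa)).
Qed.

Lemma set_type_compact (T : topologicalType) (A : set T) :
  compact A -> compact [set: set_type A].
Proof.
move=> cA; have := embedding_compact (set_type_embedding A) cA.
rewrite range_set_val (_ : _ @^-1` _ = setT); first exact.
by apply/seteqP; split=> // a _; exact: set_valP.
Qed.

Lemma set_type_hausdorff (T : topologicalType) (A : set T) :
  hausdorff_space T -> hausdorff_space (set_type A).
Proof.
move=> hT p q clq; apply: val_inj.
exact: cluster_hausdorff (@set_val_continuous _ A) hT clq.
Qed.

Lemma prod_hausdorff (X Y : topologicalType) :
  hausdorff_space X -> hausdorff_space Y -> hausdorff_space (X * Y)%type.
Proof.
move=> hX hY [p1 p2] [q1 q2] clq; congr (_, _).
  have cfst : continuous (@fst X Y) by move=> z; exact: cvg_fst.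
  exact: (cluster_hausdorff cfst hX clq).
have csnd : continuous (@snd X Y) by move=> z; exact: cvg_snd.
exact: (cluster_hausdorff csnd hY clq).
Qed.

Lemma set_type_continuous (X T : topologicalType) (A : set T)
    (f : X -> set_type A) :
  continuous (set_val \o f) -> continuous f.
Proof.
move=> /continuousP cf; apply/continuousP => _ [V oV <-].
exact: cf.
Qed.

Section coloured.
Variables (X K : topologicalType) (i : X -> K) (x : K) (c : K -> nat) (n : nat).
Hypotheses (cK : compact [set: K]) (hK : hausdorff_space K).
Hypotheses (ei : embedding i) (ri : range i = ~` [set x]).
Hypothesis cn : forall y, c y <= n.
Hypothesis c_near : forall y, y <> x -> nbhs y [set z | c z = c y].
Hypothesis c_at : forall W k, open W -> W x -> k <= n ->
  exists y, [/\ W y, y <> x & c y = k].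

(* [K] with [x] replaced by one point [(x, k)] for each colour [k]. *)
Definition coloured_set : set (K * nat) :=
  [set p | p.2 <= n /\ (p.1 = x \/ c p.1 = p.2)].

Lemma nbhs_nat_set1 (k : nat) : nbhs k [set k].
Proof. by rewrite nbhs_principalE; exact/principal_filterP. Qed.

Lemma coloured_set_compact : compact coloured_set.
Proof.
apply: (@subclosed_compact _ _ (setT `*` `I_n.+1)); last first.
- by move=> [y k] [].
- by apply: compact_setX => //; exact/finite_compact/finite_II.
- rewrite -[coloured_set]setCK; apply: open_closedC; rewrite openE => -[y k] /= nyk.
  have [kn|kn] := leqP k n; last first.
    exists (setT, [set k]); first by split; [exact: filterT|exact: nbhs_nat_set1].
    by move=> [y' k'] [_ /= ->] [/=]; rewrite leqNgt kn.
  have yx : y <> x by move=> yx; apply: nyk; split=> //; left.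
  exists ([set z | c z = c y] `&` ~` [set x], [set k]).
    split; last exact: nbhs_nat_set1.
    apply: filterI; first exact: c_near.
    apply: open_nbhs_nbhs; split => //; apply: closed_openC.
    exact: closed_point.
  move=> [y' k'] [[/= cy' y'x] ->] [_ [//|/= E]].
  by apply: nyk; split=> //; right; rewrite /= -E cy'.
Qed.

Lemma coloured_embed_subproof (a : X) : coloured_set (i a, c (i a)).
Proof. by split=> //=; right. Qed.

Definition coloured_embed (a : X) : set_type coloured_set :=
  exist (fun p => p \in coloured_set) _ (mem_set (coloured_embed_subproof a)).

Let ix a : i a <> x.
Proof. by move=> ax; have : range i x by [exists a]; rewrite ri; exact. Qed.

Lemma coloured_embed_continuous : continuous coloured_embed.
Proof.
apply: set_type_continuous => a W [[A B] [/= Ai Bc] ABW].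
have iA : nbhs a (i @^-1` A) := embedding_continuous ei Ai.
have cB : nbhs a [set b | c (i b) = c (i a)] :=
  embedding_continuous ei (c_near (@ix a)).
suff : nbhs a [set b | W (i b, c (i b))] by [].
apply: filterS (filterI iA cB) => b [Ab /= cb]; apply: ABW; split => //=.
by rewrite cb; exact: nbhs_singleton.
Qed.

Lemma coloured_remainderP (p : set_type coloured_set) :
  remainder coloured_embed p <-> (val p).1 = x.
Proof.
split=> [nr|px [a _ ap]]; last by apply: (@ix a); rewrite -px -ap.
apply: contrapT => px; apply: nr.
have [a _ ia] : range i (val p).1 by rewrite ri.
exists a => //; apply: val_inj => /=.
have [_ [//|cp]] := set_valP p.
by rewrite ia [RHS]surjective_pairing; congr (_, _).
Qed.

(** The points at infinity are the [n.+1] pairs [(x, k)] with [k <= n]; each is a limit of [X]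
    because colour [k] occurs in every neighbourhood of [x]. *)
Lemma coloured_finite_compactification :
  finite_compactification coloured_embed /\ `I_n #<= remainder coloured_embed.
Proof.
have fst_cont : continuous (fun p : set_type coloured_set => (val p).1).
  move=> p; apply: (@continuous_comp _ _ _ (set_val : set_type coloured_set -> _) fst).
    exact: set_val_continuous.
  exact: cvg_fst.
have x_in k : k <= n -> coloured_set (x, k) by move=> kn; split=> //; left.
split; last first.
  apply/pcard_surjP; exists (fun p => (val p).2) => k /= kn.
  exists (exist (fun p => p \in coloured_set) _ (mem_set (x_in k (ltnW kn)))) => //.
  exact/coloured_remainderP.
split; last first.
  apply/finite_set_leP; exists n.+1; apply/pcard_leP/injfunPex => /=.
  exists (fun p => (val p).2) => [p _ /=|p q]; first by have [] := set_valP p.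
  rewrite !inE => /coloured_remainderP px /coloured_remainderP qx pq.
  by apply: val_inj; rewrite [LHS]surjective_pairing [RHS]surjective_pairing px qx pq.
split.
- exact/set_type_compact/coloured_set_compact.
- by apply/set_type_hausdorff/prod_hausdorff => //; exact: discrete_hausdorff.
- split; first by move=> a b [/ei.1].
  move=> U; split=> [/ei.2[O oO <-]|[V oV <-]].
    exists ((fun p : set_type coloured_set => (val p).1) @^-1` O) => //.
    by move/continuousP: fst_cont; exact.
  by move/continuousP: coloured_embed_continuous; exact.
- move=> O [p Op] oO.
  have [rp|] := pselect (range coloured_embed p); first by exists p.
  move=> /coloured_remainderP px.
  have [V oV VO] := (set_type_open O).1 oO.
  move: Op; rewrite -VO /=; move: (set_valP p) px; rewrite -!set_valE.
  case: (set_val p) => _ k [/= kn _] ->.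
  move: oV; rewrite openE => /[apply] -[[W N] [/= Wx Nk] WNV].
  move: Wx; rewrite nbhsE => -[W' [oW' W'x] W'W].
  have [y [Wy yx cy]] := c_at oW' W'x kn.
  have [a _ ia] : range i y by rewrite ri.
  exists (coloured_embed a); split; last by exists a.
  apply: WNV; split => /=; rewrite ia; first exact: W'W.
  by rewrite cy; exact: nbhs_singleton.
Qed.

End coloured.

Lemma finite_compactification_ex (CH : continuum_hypothesis)
    (X K : topologicalType) (i : X -> K) (x : K) (n : nat) :
  parovichenko K -> embedding i -> range i = ~` [set x] ->
  exists (Z : topologicalType) (j : X -> Z),
    finite_compactification j /\ `I_n #<= remainder j.
Proof.
move=> pK ei ri; have [U [Uloc Ux]] := coherent_colouring pK CH x.
(* The least colour below [n] whose class contains [y], and [n] if there is none. *)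
pose c y := find (fun k => `[< U k y >]) (iota 0 n).
exists (set_type (coloured_set x c n)).
have cn y : c y <= n by rewrite -[leqRHS](size_iota 0); exact: find_size.
exists (coloured_embed i x cn).
apply: coloured_finite_compactification => //.
- exact: parovichenko_compact pK.
- exact: parovichenko_hausdorff pK.
- move=> y yx; have [B [A [cB By AP]]] := Uloc y yx.
  have agree m : nbhs y [set z | forall k, k < m -> (U k z <-> U k y)].
    elim: m => [|m IH]; first by apply: filterS filterT => z _ k.
    have Bm : nbhs y [set z | U m z <-> U m y].
      pose E := B `&` [set z | A m z <-> A m y].
      have [cA UA] := AP m.
      have : nbhs y E.
        apply: filterI; first by apply: open_nbhs_nbhs; split => //; case: cB.
        have [Ay|nAy] := pselect (A m y).
          have : nbhs y (A m) by apply: open_nbhs_nbhs; split=> //; case: cA.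
          by apply: filterS.
        have : nbhs y (~` A m).
          by apply: open_nbhs_nbhs; split=> //; case: (clopenC set0 cA).
        by apply: filterS.
      apply: filterS => z [Bz /= Az]; have := UA z Bz; have := UA y By; tauto.
    apply: filterS (filterI IH Bm) => z [h hm] k.
    by rewrite ltnS leq_eqVlt => /predU1P[->//|]; exact: h.
  apply: filterS (agree n) => z h /=; apply: eq_in_find => k.
  by rewrite mem_iota /= add0n => /h kn; apply/asbool_equiv_eq.
- move=> W k oW Wx kn.
  have [C [cC Cx CW]] := parovichenko_base pK oW Wx.
  have [y [Cy yx Uy]] := Ux C k cC Cx; exists y; split=> //; first exact: CW.
  rewrite /c (@eq_find _ _ (pred1 k)); last first.
    by move=> l /=; apply/asboolP/eqP => [/Uy|/Uy].
  move: kn; rewrite leq_eqVlt => /predU1P[->|kn].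
    rewrite hasNfind ?size_iota //; apply/hasPn => l /=.
    by rewrite mem_iota add0n => /andP[_ ln]; rewrite neq_ltn ln.
  have := @index_uniq _ 0 k (iota 0 n); rewrite size_iota nth_iota // add0n.
  by apply => //; exact: iota_uniq.
Qed.

(** * The remainder of beta omega *)

Lemma infinite_nat_ge (A : set nat) n : infinite_set A -> exists2 k, A k & n <= k.
Proof.
move=> infA; apply: contrapT => nk; apply: infA.
apply: (@sub_finite_set _ _ `I_n); last exact: finite_II.
by move=> k Ak /=; rewrite ltnNge; apply/negP => nk'; apply: nk; exists k.
Qed.

Lemma finite_nat_bounded (A : set nat) :
  finite_set A -> exists n, forall k, A k -> k < n.
Proof.
move=> /finite_seqP[s ->]; exists (\max_(k <- s) k).+1 => k ks.
by rewrite ltnS; apply: leq_bigmax_seq.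
Qed.

Lemma infinite_nat_split (A : set nat) : infinite_set A -> exists A1 A2,
  [/\ infinite_set A1, infinite_set A2, A1 `<=` A, A2 `<=` A & A1 `&` A2 = set0].
Proof.
move=> /infiniteP/pcard_leP/injfunPex[f fA finj].
have inj m n : f m = f n -> m = n by apply: finj; rewrite inE.
have inf (g : nat -> nat) : injective g -> infinite_set (range (fun n => f (g n))).
  move=> ginj; apply/infiniteP/pcard_leP/injfunPex.
  exists (fun n => f (g n)) => [n _|m n _ _ /inj/ginj//]; by exists n.
exists (range (fun n => f n.*2)), (range (fun n => f n.*2.+1)); split.
- by apply: inf; exact: double_inj.
- by apply: (inf (fun n => n.*2.+1)) => m n [/double_inj].
- by move=> _ [n _ <-]; exact: fA.
- by move=> _ [n _ <-]; exact: fA.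
- apply/seteqP; split=> // _ [[m _ <-] [n _ /inj nm]].
  by have := congr1 odd nm; rewrite /= !odd_double.
Qed.

Section omega_star.
Variables (bomega : topologicalType) (e : nat -> bomega).
Hypothesis be : stone_cech_compactification e.

Let cB : compact [set: bomega]. Proof. by case: be => -[]. Qed.
Let hB : hausdorff_space bomega. Proof. by case: be => -[]. Qed.
Let ee : embedding e. Proof. by case: be => -[]. Qed.
Let de : dense (range e). Proof. by case: be => -[]. Qed.

(** The characteristic function of [A] extends to a continuous map into the two-point space
    [bool]. *)
Lemma clopen_extension (A : set nat) :
  exists C, clopen C /\ forall n, C (e n) <-> A n.
Proof.
have [||n U /nbhs_singleton Un|g cg gE] := be.2 bool (fun n => `[< A n >]).
- exact/finite_compact/finite_finset.
- exact: discrete_hausdorff.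
- suff : nbhs n [set m | U `[< A m >]] by [].
  by rewrite nbhs_principalE; apply/principal_filterP.
exists (g @^-1` [set true]); split.
  apply: preimage_clopen => //; split; first exact: discrete_open.
  exact: discrete_closed.
move=> n; have : (g \o e) n = `[< A n >] by rewrite gE.
by move=> /= gn; rewrite /= gn; split=> [/asboolP|/asboolP].
Qed.

Lemma open_dense_point (U : set bomega) p : open U -> U p -> exists n, U (e n).
Proof.
move=> oU Up; have [|z [Uz [n _ nz]]] := de _ oU; first by exists p.
by exists n; rewrite nz.
Qed.

Lemma clopen_sub (C D : set bomega) : clopen C -> clopen D ->
  (forall n, C (e n) -> D (e n)) -> C `<=` D.
Proof.
move=> cC cD CD p Cp; apply: contrapT => nDp.
have [oE _] := clopenD cC cD.
by have [n [/CD]] := open_dense_point oE (conj Cp nDp).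
Qed.

Lemma open_isolated n : open [set e n].
Proof.
have on : open [set n] by exact: discrete_open.
have [V oV Vn] := (ee.2 [set n]).1 on.
have En k : V (e k) -> k = n by move=> Vk; have : (e @^-1` V) k by []; rewrite Vn.
rewrite (_ : [set e n] = V) //; apply/seteqP; split=> [_ ->|p Vp].
  by have : [set n] n by []; rewrite -Vn.
apply: contrapT => /= pn.
have oU : open (V `\` [set e n]).
  by apply: openI => //; apply: closed_openC; exact: closed_point.
have [k [/En -> ]] := open_dense_point oU (conj Vp pn); exact.
Qed.

Lemma remainder_closed : closed (remainder e).
Proof.
apply: open_closedC; rewrite (_ : range e = \bigcup_n [set e n]).
  by apply: bigcup_open => n _; exact: open_isolated.
by apply/seteqP; split=> [_ [n _ <-]|_ [n _ ->]]; exists n.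
Qed.

(** Removing a finite trace from [C] would leave a nonempty open set disjoint from the dense
    range. *)
Lemma remainder_infinite_trace (C : set bomega) p : open C -> C p ->
  remainder e p -> infinite_set [set n | C (e n)].
Proof.
move=> oC Cp rp fin.
have cl : closed (e @` [set n | C (e n)]).
  apply: (accessible_finite_set_closed.1 (hausdorff_accessible hB)).
  exact: finite_image.
have oU : open (C `\` e @` [set n | C (e n)]).
  by apply: openI => //; exact: closed_openC.
have [|n [Cn]] := @open_dense_point _ p oU.
  by split=> // -[n _ np]; apply: rp; exists n.
by apply; exists n.
Qed.

Lemma infinite_trace_remainder (C : set bomega) : closed C ->
  infinite_set [set n | C (e n)] -> exists2 p, C p & remainder e p.
Proof.
move=> clC infC.
have [n|n p [Cp h]|n|p Cp] := @compact_decreasing bomega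
    (fun n => C `&` [set p | forall k, k < n -> p <> e k]) cB.
- apply: closedI => //.
  rewrite (_ : mkset _ = \bigcap_(k in `I_n) ~` [set e k]).
    by apply: closed_bigI => k _; apply: open_closedC; exact: open_isolated.
  by apply/seteqP; split.
- by split=> // k kn; apply: h; rewrite ltnS ltnW.
- have [k Ck nk] := infinite_nat_ge n infC.
  exists (e k); split=> // l ln /ee.1 kl.
  by move: nk; rewrite leqNgt kl ln.
- exists p; first by have [] := Cp 0.
  by move=> [n _ np]; have [_ /(_ n (ltnSn n))] := Cp n.+1; exact.
Qed.

(** By density of the range, this is the closure of the image of [A]. *)
Definition star_closure (A : set nat) : set bomega :=
  projT1 (cid (clopen_extension A)).

Lemma clopen_star_closure A : clopen (star_closure A).
Proof. by rewrite /star_closure; case: cid => C []. Qed.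

Lemma star_closureE A n : star_closure A (e n) <-> A n.
Proof. by rewrite /star_closure; case: cid => C [_ /=]. Qed.

Let W := set_type (remainder e).

(** Usually written $A^*$; by [star_sub] it depends on [A] only modulo finite sets. *)
Definition star (A : set nat) : set W := set_val @^-1` star_closure A.

Lemma clopen_star A : clopen (star A).
Proof.
apply: preimage_clopen; first exact: clopen_star_closure.
exact: set_val_continuous.
Qed.

Lemma star_sub A B : finite_set (A `\` B) -> star A `<=` star B.
Proof.
move=> fin p Ap; apply: contrapT => nBp.
have [oE _] := clopenD (clopen_star_closure A) (clopen_star_closure B).
apply: (remainder_infinite_trace oE (conj Ap nBp) (set_valP p)).
by apply: sub_finite_set fin => n [/star_closureE ? nB]; split=> // /star_closureE.
Qed.

Lemma star_infinite A p : star A p -> infinite_set A.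
Proof.
have [oA _] := clopen_star_closure A.
move=> Ap fin; apply: (remainder_infinite_trace oA Ap (set_valP p)).
by apply: sub_finite_set fin => n /star_closureE.
Qed.

Lemma star_nonempty A : infinite_set A -> star A !=set0.
Proof.
move=> inf; have [||p Ap rp] := @infinite_trace_remainder (star_closure A).
- by case: (clopen_star_closure A).
- by apply: sub_infinite_set inf => n An; apply/star_closureE.
- have : range (set_val : W -> _) p by rewrite range_set_val.
  by move=> [q _ qp]; exists q; rewrite /star /= qp.
Qed.

Lemma starI A B : star (A `&` B) = star A `&` star B.
Proof.
apply/seteqP; split=> [p ABp|].
  by split; apply: star_sub ABp; rewrite (_ : _ `\` _ = set0) //;
    apply/seteqP; split=> // n [[? ?]].
move=> p [Ap Bp].
apply: (@clopen_sub (star_closure A `&` star_closure B)) => //.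
- by apply: clopenI; exact: clopen_star_closure.
- exact: clopen_star_closure.
- by move=> n [/star_closureE ? /star_closureE ?]; apply/star_closureE.
Qed.

Lemma starC A : star (~` A) = ~` star A.
Proof.
apply/seteqP; split=> p.
  move=> nAp Ap; have : star (~` A `&` A) p by rewrite starI.
  by rewrite setICl => /star_infinite; apply; exact: finite_set0.
move=> nAp; apply: (@clopen_sub (~` star_closure A)) => //.
- by apply: (clopenC set0); exact: clopen_star_closure.
- exact: clopen_star_closure.
- by move=> n nA; apply/star_closureE => An; apply/nA/star_closureE.
Qed.

Lemma star0 : star set0 = set0.
Proof. by apply/seteqP; split=> // p /star_infinite; apply; exact: finite_set0. Qed.

Lemma starU A B : star (A `|` B) = star A `|` star B.
Proof. by rewrite -[LHS]setCK -starC setCU starI !starC setCI !setCK. Qed.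

Lemma star_base (U : set W) z : open U -> U z -> exists2 A, star A z & star A `<=` U.
Proof.
move=> [V oV <-] /= Vz.
have reg : {for set_val z, regular_space bomega}.
  by apply: compact_regular hB cB _; exact: filterT.
have [|N Nz NV] := reg V; first by apply: open_nbhs_nbhs.
(* By density, the closure of this trace contains the interior of [N] and lies in the closure of
   [N], hence in [V]. *)
exists [set n | N° (e n)].
  apply: contrapT => nz.
  have oE : open (N° `&` ~` star_closure [set n | N° (e n)]).
    apply: openI; first exact: open_interior.
    by have [] := clopenC set0 (clopen_star_closure [set n | N° (e n)]).
  have [n [Nn nn]] := open_dense_point oE (conj (nbhs_singleton (nbhs_interior Nz)) nz).
  by apply/nn/star_closureE.
move=> p Ap; apply: NV; apply: contrapT => nNp.
have oE : open (star_closure [set n | N° (e n)] `\` closure N).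
  apply: openI; first by have [] := clopen_star_closure [set n | N° (e n)].
  by apply: closed_openC; exact: closed_closure.
have [n [/star_closureE/= Nn nNn]] := open_dense_point oE (conj Ap nNp).
by apply: nNn; apply: subset_closure; exact: interior_subset.
Qed.

Lemma compact_omega_star : compact [set: W].
Proof. exact/set_type_compact/(subclosed_compact remainder_closed cB). Qed.

Lemma clopen_starP (D : set W) : clopen D -> exists A, star A = D.
Proof.
move=> cD.
suff [A] : exists A, star A = D `&` setT by rewrite setIT; exists A.
apply: (@clopen_induction W (fun T => exists A, star A = D `&` T)).
- exact: compact_omega_star.
- by exists set0; rewrite setI0 star0.
- by move=> T1 T2 [A1 E1] [A2 E2]; exists (A1 `|` A2); rewrite starU setIUr E1 E2.
- move=> z; have [Dz|nDz] := pselect (D z).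
    have [A Az AD] := star_base cD.1 Dz.
    exists (star A); split=> //; first exact: clopen_star.
    by exists A; apply/seteqP; split=> [p Ap|p []//]; split=> //; exact: AD.
  have [A Az AD] := star_base (clopenC set0 cD).1 nDz.
  exists (star A); split=> //; first exact: clopen_star.
  by exists set0; rewrite star0; apply/seteqP; split=> // p [Dp /AD].
Qed.

(** Choosing [d n] in [B n] with [n <= d n] yields an infinite set that is almost contained in every
    [B n]. *)
Lemma omega_star_gdelta (C : nat -> set W) : (forall n, clopen (C n)) ->
  (forall n, C n.+1 `<=` C n) -> (forall n, C n !=set0) ->
  exists D, [/\ clopen D, D !=set0 & forall n, D `<=` C n].
Proof.
move=> cC decC C0.
have /choice[A AC] : forall n, exists A, star A = C n by move=> n; exact: clopen_starP.
(* The sets [A n] decrease only modulo finite sets; their partial intersections decrease outright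
   and represent the same [C n]. *)
pose B := fix B n := if n is m.+1 then B m `&` A m.+1 else A 0.
have BC n : star (B n) = C n.
  elim: n => [|n IH] /=; first exact: AC.
  by rewrite starI IH AC; apply/setIidPr.
have decB : forall n, B n.+1 `<=` B n by move=> n k [].
have subB := decreasing_subset decB.
have infB n : infinite_set (B n).
  by have [p] := C0 n; rewrite -BC => /star_infinite.
have /choice[d dP] : forall n, exists k, B n k /\ n <= k.
  by move=> n; have [k] := infinite_nat_ge n (infB n); exists k.
exists (star (range d)); split.
- exact: clopen_star.
- apply: star_nonempty => /finite_nat_bounded[n nd].
  have : d n < n by apply: nd; exists n.
  by rewrite ltnNge; have [_ ->] := dP n.
- move=> n; rewrite -BC; apply: star_sub.
  apply: (@sub_finite_set _ _ (d @` `I_n)); last exact/finite_image/finite_II.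
  move=> _ [[k _ <-] nB]; exists k => //=; rewrite ltnNge; apply/negP => nk.
  by apply: nB; apply: (subB n k nk); have [] := dP k.
Qed.

(** All intersections of an [a m] with a [b n] are finite. The set [S] collects the numbers that
    enter some [a n] before entering any [b m], so it almost contains each [a n] and is almost
    disjoint from each [b m]. *)
Lemma omega_star_separation (F G : set (set W)) :
  countable F -> countable G -> F `<=` clopen -> G `<=` clopen ->
  (forall A B, F A -> G B -> A `&` B = set0) ->
  exists S, [/\ clopen S, forall A, F A -> A `<=` S
              & forall B, G B -> B `<=` ~` S].
Proof.
move=> cF cG clF clG FG.
have [u [uF Fu]] := countable_enum set0 cF.
have [v [vG Gv]] := countable_enum set0 cG.
have /choice[a au] : forall n, exists A, star A = u n.
  by move=> n; have [/clF/clopen_starP//|->] := Fu n; exists set0; rewrite star0.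
have /choice[b bv] : forall n, exists A, star A = v n.
  by move=> n; have [/clG/clopen_starP//|->] := Gv n; exists set0; rewrite star0.
have fin m n : finite_set (a m `&` b n).
  apply: contrapT => /star_nonempty[p]; rewrite starI au bv.
  have [Fm|->] := Fu m; last by rewrite set0I.
  by have [Gn|->] := Gv n; [rewrite FG|rewrite setI0].
pose S := [set k | exists n, a n k /\ forall m, m <= n -> ~ b m k].
exists (star S); split; first exact: clopen_star.
  move=> A /uF[n <-]; rewrite -au; apply: star_sub.
  apply: (@sub_finite_set _ _ (\bigcup_(m in `I_n.+1) (a n `&` b m))).
    move=> k [ank nS]; apply: contrapT => nU; apply: nS; exists n; split=> // m mn bm.
    by apply: nU; exists m.
  by apply: bigcup_finite => //; exact: finite_II.
move=> B /vG[m <-]; rewrite -bv -starC; apply: star_sub.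
apply: (@sub_finite_set _ _ (\bigcup_(n in `I_m) (a n `&` b m))).
  move=> k [bmk /contrapT[n [ank nb]]]; exists n => //=.
  by rewrite ltnNge; apply/negP => mn; exact: nb mn bmk.
by apply: bigcup_finite => //; exact: finite_II.
Qed.

Lemma omega_star_parovichenko : parovichenko W.
Proof.
split.
- exact: compact_omega_star.
- exact: set_type_hausdorff.
- move=> U z oU Uz; have [A Az AU] := star_base oU Uz.
  by exists (star A); split=> //; exact: clopen_star.
- have [p _] := star_nonempty infinite_nat.
  by exists p.
- move=> z oz; have [A Az Asub] := star_base oz (erefl z).
  have [A1 [A2 [/star_nonempty[p1 p1P] /star_nonempty[p2 p2P] s1 s2 dis]]] :=
    infinite_nat_split (star_infinite Az).
  have sub B : B `<=` A -> star B `<=` [set z].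
    move=> BA p Bp; apply: Asub; apply: star_sub Bp.
    by rewrite (_ : _ `\` _ = set0) //; apply/seteqP; split=> // n [/BA].
  have p12 : p1 = p2 by rewrite (sub _ s1 _ p1P) (sub _ s2 _ p2P).
  have : star (A1 `&` A2) p1 by rewrite starI; split=> //; rewrite p12.
  by rewrite dis star0.
- exact: omega_star_gdelta.
- exact: omega_star_separation.
- by exists star; exact: clopen_starP.
Qed.

End omega_star.

(* [set_type A] is the subspace [A]: here omega* minus the point [x], and,
   in the second clause, omega* itself; [nat] has the discrete topology. *)
Theorem theorem4p5 (CH : continuum_hypothesis)
    (bomega : topologicalType) (e : nat -> bomega)
    (be : stone_cech_compactification e)
    (x : bomega) (xstar : remainder e x) :
  [/\ forall n : nat,
        exists (Z : topologicalType) (j : set_type (remainder e `\ x) -> Z),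
          finite_compactification j /\ `I_n #<= remainder j,
      forall (Z : topologicalType) (j : set_type (remainder e `\ x) -> Z),
        finite_compactification j ->
        homeomorphic Z (set_type (remainder e))
    & forall (Z : topologicalType) (j : set_type (remainder e `\ x) -> Z),
        finite_compactification j ->
        is_subset1 (remainder j `\` @P_point Z)].
Proof.
pose W := set_type (remainder e).
have pW : parovichenko W := omega_star_parovichenko be.
have [xW _ xWE] : range (set_val : W -> bomega) x by rewrite range_set_val.
(* The subspace without [x] is mapped into omega*, where it becomes the complement of [xW], the copy
   of [x] there. *)
pose i (a : set_type (remainder e `\ x)) : W :=
  exist (fun p => p \in remainder e) (set_val a) (mem_set (set_valP a).1).
have iE a : set_val (i a) = set_val a by [].
have ei : embedding i.
  split=> [a b ab|U]; first by apply: val_inj; have := congr1 set_val ab.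
  split=> [[V oV <-]|[_ [V oV <-] <-]]; last by exists V.
  by exists (set_val @^-1` V) => //; exists V.
have ri : range i = ~` [set xW].
  apply/seteqP; split=> [_ [a _ <-] /= ax|y yx].
    have [_] := set_valP a; apply.
    by have := congr1 set_val ax; rewrite xWE.
  have : range (set_val : set_type (remainder e `\ x) -> _) (set_val y).
    rewrite range_set_val; split; first exact: set_valP.
    by move=> /= yE; apply: yx; apply: val_inj; rewrite [RHS]xWE.
  by move=> [a _ ay]; exists a => //; apply: val_inj.
split.
- by move=> n; refine (finite_compactification_ex CH n pW ei ri).
- move=> Z j fj; apply: parovichenko_homeomorphic => //.
  exact: finite_compactification_parovichenko pW ei ri fj.
- by move=> Z j fj; exact: finite_compactification_P_point pW ei ri fj.
Qed.
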